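(* Let $\psi,\xi\in H^1_0(\Omega)$, let $k\ge1$, and let $\mathcal{Q}^k_{\psi,T},\mathcal{Q}^k_{\xi,T}$ ($T\in\mathcal{T}_H$) be the localized element correctors and $\mathcal{Q}^k_\psi,\mathcal{Q}^k_\xi$ the corresponding global truncated correctors defined in the context. For $T\in\mathcal{T}_H$ set $$e_T(\xi,\psi)^2:=\sum_{T'\in N^k(T)}\|\alpha(\cdot,\xi)-\alpha(\cdot,\psi)\|_{L^\infty(T')}^2\cdot\max_{w|_T:\,w\in V_H}\frac{\|\chi_T\nabla w-\nabla\mathcal{Q}^k_{\psi,T}w\|_{0,T'}^2}{\|\nabla w\|_{0,T}^2}.$$ Then for all $v_H\in V_H$ and all $T\in\mathcal{T}_H$, $$|(\mathcal{Q}^k_{\xi,T}-\mathcal{Q}^k_{\psi,T})v_H|_1\le\lambda^{-1}\,e_T(\xi,\psi)\,|v_H|_{1,T}.$$ Moreover, for all $v_H\in V_H$, $$|(\mathcal{Q}^k_\xi-\mathcal{Q}^k_\psi)v_H|_1\le\lambda^{-1}\,C_{\mathrm{ol}}^{1/2}\Bigl(\max_{T\in\mathcal{T}_H}e_T(\xi,\psi)\Bigr)|v_H|_1.$$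
   Context: Norms: $\|\cdot\|_{0,D}$ is the $L^2(D)$-norm, $|v|_{1,D}=\|\nabla v\|_{0,D}$, and $|\cdot|_1=|\cdot|_{1,\Omega}$. $\chi_T$ is the indicator function of $T$. The maximum in $e_T$ is over restrictions to $T$ of $w\in V_H$ with $\nabla w\ne0$ on $T$. Coefficient. $\Omega\subset\mathbb{R}^d$, $d\in\{1,2,3\}$, is a bounded Lipschitz domain. The scalar coefficient $\alpha:\Omega\times\mathbb{R}\to\mathbb{R}$ satisfies $\alpha(\cdot,s)\in L^\infty(\Omega)$ and, for constants $L_c,\lambda,\Lambda>0$ and all $x\in\Omega$, $s,s_1,s_2\in\mathbb{R}$, $\psi\in\mathbb{R}^d$: $|\alpha(x,s_1)-\alpha(x,s_2)|\le L_c|s_1-s_2|$, $\alpha(x,s)\psi\cdot\psi\ge\lambda|\psi|^2$, $|\alpha(x,s)\psi|\le\Lambda|\psi|$. For a subdomain $D\subset\Omega$ put $\mathcal{A}_D(\phi;u,v)=\int_D\alpha(x,\phi)\nabla u\cdot\nabla v\,dx$. Mesh and spaces. $\mathcal{T}_H$ is a shape-regular, quasi-uniform mesh of $\Omega$ into simplices or quadrilaterals with maximal element diameter $H$, and $V_H\subset H^1_0(\Omega)$ is the standard first-order conforming finite element space. $I_H:H^1_0(\Omega)\to V_H$ is a linear bounded projection ($I_Hv_H=v_H$ for $v_H\in V_H$) with $|I_Hv|_{1,T}+H^{-1}\|v-I_Hv\|_{0,T}\le C_{\mathrm{proj}}|v|_{1,N(T)}$ for all $v\in H^1_0(\Omega)$,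 $T\in\mathcal{T}_H$, and $W=\ker I_H$. Here $N(T)$ is the patch of elements $T'\in\mathcal{T}_H$ having non-empty intersection with $T$. The $k$-layer patches are $N^1(T)=N(T)$, $N^k(T)=N(N^{k-1}(T))$; $N^k(T)$ denotes both the set of elements and the subdomain they cover. $C_{\mathrm{ol}}$ is a constant (depending only on $k$, polynomially) with $\max_{T\in\mathcal{T}_H}|\{T'\in\mathcal{T}_H:T'\in N^k(T)\}|\le C_{\mathrm{ol}}$. Correctors. $W(N^k(T))=\{w\in W:\operatorname{supp}w\subseteq\overline{N^k(T)}\}$. For $\phi\in H^1_0(\Omega)$, $\mathcal{Q}^k_{\phi,T}:V_H\to W(N^k(T))$ is defined by $\mathcal{A}_{N^k(T)}(\phi;\mathcal{Q}^k_{\phi,T}v_H,w)=\mathcal{A}_T(\phi;v_H,w)$ for all $w\in W(N^k(T))$, and $\mathcal{Q}^k_\phi=\sum_{T\in\mathcal{T}_H}\mathcal{Q}^k_{\phi,T}$. *)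

(* Defs.v *)
(* R^d is 'rV[R]_d. *)
From HB Require Import structures.
From mathcomp Require Import all_boot all_order all_algebra.
From mathcomp Require Import all_classical all_reals all_analysis.
Set Implicit Arguments.
Unset Strict Implicit.
Unset Printing Implicit Defensive.
Import Order.TTheory GRing.Theory Num.Theory.
Import numFieldNormedType.Exports.
Local Open Scope classical_set_scope.
Local Open Scope ring_scope.

(* Lebesgue measure on R^d: the library has none, so it is built by iterated
   products.  The sigma-algebra is the one generated by the coordinates, as the
   library does for tuples; on R^d this is the Borel sigma-algebra. *)

Section measurable_rV.
Context {R : realType} (n : nat).

Let coord (i : 'I_n) (x : 'rV[R]_n) : R := x ord0 i.

Let rV_set0 : g_sigma_preimage coord set0.
Proof. exact: sigma_algebra0. Qed.

Let rV_setC A : g_sigma_preimage coord A -> g_sigma_preimage coord (~` A).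
Proof. exact: sigma_algebraC. Qed.

Let rV_bigcup (F : (set 'rV[R]_n)^nat) :
  (forall i, g_sigma_preimage coord (F i)) ->
  g_sigma_preimage coord (\bigcup_i F i).
Proof. exact: sigma_algebra_bigcup. Qed.

HB.instance Definition _ := @isMeasurable.Build
  (measure_tuple_display default_measure_display)
  'rV[R]_n (g_sigma_preimage coord) rV_set0 rV_setC rV_bigcup.

Lemma measurable_coord (i : 'I_n) :
  measurable_fun [set: 'rV[R]_n] (fun x : 'rV[R]_n => x ord0 i).
Proof.
move=> _ Y mY; rewrite setTI; apply: sub_sigma_algebra => /=.
rewrite -bigcup_seq/=; exists i => /=; first by rewrite mem_index_enum.
by exists Y => //; rewrite setTI.
Qed.

Lemma measurable_fun_rV d (T : measurableType d) (f : T -> 'rV[R]_n) :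
  (forall i, measurable_fun [set: T] (fun t => f t ord0 i)) ->
  measurable_fun [set: T] f.
Proof.
move=> mf _ Y mY; rewrite setTI; move: Y mY.
apply: smallest_sub.
  split=> [|A mA|F mF]; rewrite /= ?preimage_set0//.
  - by rewrite setTD preimage_setC; exact: measurableC.
  - by rewrite preimage_bigcup; exact: bigcup_measurable.
rewrite -bigcup_seq; apply: bigcup_sub => i _ _ [B mB <-] /=.
by have := mf i measurableT _ mB; rewrite !setTI.
Qed.

End measurable_rV.

Section lebesgue_rV.
Context {R : realType}.

Definition rVcons n (x : measurableTypeR R * 'rV[R]_n) : 'rV[R]_n.+1 :=
  \row_i (if unlift ord0 i is Some j then x.2 ord0 j else x.1).

Definition rVuncons n (y : 'rV[R]_n.+1) : measurableTypeR R * 'rV[R]_n :=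
  (y ord0 ord0, \row_j y ord0 (lift ord0 j)).

Lemma rVconsK n : cancel (@rVcons n) (@rVuncons n).
Proof.
move=> [t x]; rewrite /rVuncons /rVcons !mxE unlift_none/=; congr pair.
by apply/rowP => j; rewrite !mxE liftK.
Qed.

Lemma measurable_rVcons n : measurable_fun [set: _] (@rVcons n).
Proof.
apply: measurable_fun_rV => i; rewrite /rVcons.
case: (unliftP ord0 i) => [j ->|->].
- rewrite (_ : (fun t => _) = (fun x : 'rV[R]_n => x ord0 j) \o snd).
    by apply: measurableT_comp => //; exact: measurable_coord.
  by apply/funext => t /=; rewrite mxE liftK.
- rewrite (_ : (fun t => _) = fst); first exact: measurable_fst.
  by apply/funext => t /=; rewrite mxE unlift_none.
Qed.

Lemma measurable_rVuncons n : measurable_fun [set: _] (@rVuncons n).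
Proof.
apply/measurable_fun_pairP; split.
  exact: (@measurable_coord R n.+1 ord0).
apply: measurable_fun_rV => j.
rewrite (_ : (fun t => _) = fun y : 'rV[R]_n.+1 => y ord0 (lift ord0 j)).
  exact: measurable_coord.
by apply/funext => y /=; rewrite mxE.
Qed.

Section rVcons_measure.
Context n (m : {sigma_finite_measure set 'rV[R]_n -> \bar R}).

Definition rVcons_measure : set 'rV[R]_n.+1 -> \bar R :=
  pushforward (@lebesgue_measure R \x m)%E (@rVcons n).

HB.instance Definition _ := Measure.copy rVcons_measure
  (measure_function_pushforward__canonical__measure_function_Measure
     (@lebesgue_measure R \x m)%E (@measurable_rVcons n)).

Let rVcons_measure_sigma_finite : sigma_finite setT rVcons_measure.
Proof.
have /sigma_finiteP[F [FT ndF Foo]] := sigma_finiteT (@lebesgue_measure R).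
have /sigma_finiteP[G [GT ndG Goo]] := sigma_finiteT m.
exists (fun k => @rVuncons n @^-1` (F k `*` G k)).
  apply/esym; rewrite -subTset => y _.
  have : [set: measurableTypeR R] (rVuncons y).1 by [].
  have : [set: 'rV[R]_n] (rVuncons y).2 by [].
  rewrite FT GT => -[j _ Gj] [i _ Fi]; exists (maxn i j) => //; split.
    by move: Fi; exact/subsetPset/ndF/leq_maxl.
  by move: Gj; exact/subsetPset/ndG/leq_maxr.
move=> k; have [mF Fk] := Foo k; have [mG Gk] := Goo k; split.
  rewrite -[X in measurable X]setTI; apply: measurable_rVuncons => //.
  exact: measurableX.
rewrite /rVcons_measure /pushforward -comp_preimage.
rewrite (_ : _ @^-1` (F k `*` G k) = F k `*` G k).
  by rewrite product_measure1E// lte_mul_pinfty// ge0_fin_numE.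
by rewrite (_ : _ \o _ = id)//; apply/funext => x; exact: rVconsK.
Qed.

HB.instance Definition _ := Measure_isSigmaFinite.Build _ _ _
  rVcons_measure rVcons_measure_sigma_finite.

End rVcons_measure.

Fixpoint leb (n : nat) : {sigma_finite_measure set 'rV[R]_n -> \bar R} :=
  if n is k.+1 then rVcons_measure (leb k) else \d_(0 : 'rV[R]_0).

End lebesgue_rV.
Arguments leb {R} n.

Section euclidean.
Context {R : realType} {d : nat}.
Implicit Types x y : 'rV[R]_d.

Definition dot x y : R := \sum_(i < d) x ord0 i * y ord0 i.

(* The library norm on 'rV[R]_d is the sup norm. *)
Definition enorm x : R := Num.sqrt (dot x x).

Definition diam (A : set 'rV[R]_d) : R :=
  sup [set enorm (x - y) | x in A & y in A].

End euclidean.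

(* Sobolev spaces.  An element of L^2(Om), H^1(Om), etc. is represented by a
   function on R^d of which only the values on Om matter, up to null sets;
   equality in these spaces is therefore rendered by [ae_eq]. *)

Section sobolev.
Context {R : realType} {d : nat}.
Implicit Types (Om D : set 'rV[R]_d) (u v w phi : 'rV[R]_d -> R).
Implicit Types (g : 'rV[R]_d -> 'rV[R]_d).

Definition partial (i : 'I_d) u : 'rV[R]_d -> R :=
  fun x => 'D_(delta_mx ord0 i) u x.

Definition smooth u := forall s : seq 'I_d,
  continuous (foldr partial u s) /\
  forall x i, derivable (foldr partial u s) x (delta_mx ord0 i).

Definition test_function Om phi :=
  [/\ smooth phi,
      compact (closure [set x | phi x != 0]) &
      closure [set x | phi x != 0] `<=` Om].

Definition grad u : 'rV[R]_d -> 'rV[R]_d := fun x => \row_i partial i u x.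

Definition L2 Om u := measurable_fun Om u /\
  (\int[leb d]_(x in Om) ((u x ^+ 2)%:E) < +oo)%E.

Definition is_wgrad Om u g :=
  (forall i, L2 Om (fun x => g x ord0 i)) /\
  forall phi i, test_function Om phi ->
    \int[leb d]_(x in Om) (u x * partial i phi x) =
    - \int[leb d]_(x in Om) (g x ord0 i * phi x).

Definition H1 Om u := L2 Om u /\ exists g, is_wgrad Om u g.

(* The weak gradient, unique up to null sets (junk if u is not in H^1(Om)). *)
Definition wgrad Om u : 'rV[R]_d -> 'rV[R]_d := xget (cst 0) (is_wgrad Om u).

Definition l2norm D u : R := Num.sqrt (\int[leb d]_(x in D) (u x ^+ 2)).

Definition l2norm_vec D g : R := Num.sqrt (\int[leb d]_(x in D) dot (g x) (g x)).

(* Norms over D are taken over D `&` Om: the closed mesh elements may contain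
   (null) pieces of the boundary of Om, where functions have no meaning. *)
Definition norm0 Om D v : R := l2norm (D `&` Om) v.
Definition semi1 Om D v : R := l2norm_vec (D `&` Om) (wgrad Om v).

Definition norm1 Om v : R := Num.sqrt (norm0 Om Om v ^+ 2 + semi1 Om Om v ^+ 2).

(* Closure of the test functions in H^1(Om). *)
Definition H10 Om u := H1 Om u /\
  forall eps : R, 0 < eps -> exists2 phi, test_function Om phi &
    Num.sqrt (l2norm Om (u \- phi) ^+ 2 +
              l2norm_vec Om (fun x => wgrad Om u x - grad phi x) ^+ 2) < eps.

(* Support in the sense of measurable functions on Om. *)
Definition ess_supp Om w : set 'rV[R]_d :=
  [set x | forall U, open U -> U x -> ~ ae_eq (leb d) (U `&` Om) w (cst 0)].

Definition linf_norm Om D u : R :=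
  fine ('N[leb d]_(+oo%E)[EFin \o (u \_ (D `&` Om))])%E.

(* Near each boundary point Om is, in suitable orthonormal coordinates with last
   axis e, the strict epigraph of a Lipschitz function gam of the coordinates
   orthogonal to e. *)
Definition lipschitz_boundary Om := forall x, closure Om x -> ~ Om x ->
  exists (e : 'rV[R]_d) (gam : 'rV[R]_d -> R) (L r : R),
    [/\ enorm e = 1, 0 < r,
        forall y t, gam (y + t *: e) = gam y,
        forall y z, `|gam y - gam z| <= L * enorm (y - z) &
        forall y, enorm (y - x) < r -> (Om y <-> gam y < dot y e)].

Definition lipschitz_domain Om :=
  [/\ open Om, connected Om, Om !=set0, bounded_set Om & lipschitz_boundary Om].

End sobolev.

Section mesh.
Context {R : realType} {d : nat}.

(* [Quad] is the d-cube type: quadrilaterals for d = 2, hexahedra for d = 3. *)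
Inductive cell := Simplex | Quad.

Definition refcell (k : cell) : set 'rV[R]_d :=
  match k with
  | Simplex => [set x | (forall i, 0 <= x ord0 i) /\ \sum_i x ord0 i <= 1]
  | Quad => [set x | forall i, 0 <= x ord0 i <= 1]
  end.

Definition facet (k : cell) (A : set 'rV[R]_d) : Prop :=
  match k with
  | Simplex => (exists i, A = refcell k `&` [set x | x ord0 i = 0]) \/
               A = refcell k `&` [set x | \sum_i x ord0 i = 1]
  | Quad => exists i (b : bool), A = refcell k `&` [set x | x ord0 i = b%:R]
  end.

(* Proper faces, of any dimension; the empty set is one of them. *)
Definition proper_face (k : cell) (A : set 'rV[R]_d) : Prop :=
  exists F : set (set 'rV[R]_d),
    [/\ F !=set0, F `<=` facet k & A = \bigcap_(B in F) B].

(* P_1 on simplices, Q_1 (degree at most one in each variable) on cubes. *)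
Definition shape_function (k : cell) (p : 'rV[R]_d -> R) : Prop :=
  match k with
  | Simplex => exists (c : R) (a : 'rV[R]_d), forall x, p x = c + dot a x
  | Quad => exists c : {set 'I_d} -> R,
      forall x, p x = \sum_(S : {set 'I_d}) c S * \prod_(i in S) x ord0 i
  end.

(* Each element T is the image of a reference cell under its map [emap T]. *)
Record cells := Cells {
  elt : finType;
  kind : elt -> cell;
  emap : elt -> 'rV[R]_d -> 'rV[R]_d }.

Implicit Types (Om : set 'rV[R]_d) (M : cells) (v w : 'rV[R]_d -> R).

Definition body M (T : elt M) : set 'rV[R]_d := emap T @` refcell (kind T).

Definition mesh_size M : R := \big[Num.max/0]_(T : elt M) diam (body T).

Definition is_mesh Om M : Prop :=
  [/\ forall (T : elt M) i, shape_function (kind T) (fun x => emap T x ord0 i),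
      forall T : elt M, {in refcell (kind T) &, injective (emap T)},
      forall (T : elt M) x, refcell (kind T) x -> \det ('J (emap T) x) != 0,
      closure Om = \bigcup_(T in [set: elt M]) body T &
      forall T T' : elt M, T != T' -> exists A A',
        [/\ proper_face (kind T) A, proper_face (kind T') A',
            body T `&` body T' = emap T @` A &
            body T `&` body T' = emap T' @` A']].

(* The closed ball of radius rho is inscribed in T: sigma bounds the ratio of the
   diameter of T to that of its inscribed ball. *)
Definition shape_regular M (sigma : R) : Prop := forall T : elt M,
  exists x (rho : R), [/\ 0 < rho,
    [set y | enorm (y - x) <= rho] `<=` body T &
    diam (body T) <= sigma * (2 * rho)].

Definition quasi_uniform M (tau : R) : Prop :=
  forall T : elt M, mesh_size M <= tau * diam (body T).

Definition neighbours M (S : {set elt M}) : {set elt M} :=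
  finset (fun T' => `[< exists2 T, T \in S & body T' `&` body T !=set0 >]).

(* [layers k T] is N^k(T), as a set of elements. *)
Definition layers M (k : nat) (T : elt M) : {set elt M} :=
  iter k (@neighbours M) (finset.set1 T).

Definition region M (S : {set elt M}) : set 'rV[R]_d :=
  \bigcup_(T in [set` S]) body T.

Definition VH Om M v : Prop :=
  [/\ H10 Om v, {within closure Om, continuous v} &
      forall T : elt M, exists2 p, shape_function (kind T) p &
        forall x, refcell (kind T) x -> v (emap T x) = p x].

Definition is_interpolation Om M (Cproj : R)
    (I : ('rV[R]_d -> R) -> 'rV[R]_d -> R) : Prop :=
  [/\ forall v, H10 Om v -> VH Om M (I v),
      forall (a : R) u v, H10 Om u -> H10 Om v ->
        ae_eq (leb d) Om (I (fun x => a * u x + v x))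
                         (fun x => a * I u x + I v x),
      exists C : R, forall v, H10 Om v -> norm1 Om (I v) <= C * norm1 Om v,
      forall v, VH Om M v -> ae_eq (leb d) Om (I v) v &
      forall v (T : elt M), H10 Om v ->
        semi1 Om (body T) (I v) +
          (mesh_size M)^-1 * norm0 Om (body T) (v \- I v)
        <= Cproj * semi1 Om (region (layers 1 T)) v].

Definition W Om (I : ('rV[R]_d -> R) -> 'rV[R]_d -> R) w : Prop :=
  H10 Om w /\ ae_eq (leb d) Om (I w) (cst 0).

Definition Wpatch Om M I k (T : elt M) w : Prop :=
  W Om I w /\ ess_supp Om w `<=` closure (region (layers k T)).

End mesh.
Arguments cells R d : clear implicits.

Section correctors.
Context {R : realType} {d : nat}.
Implicit Types (Om D : set 'rV[R]_d) (M : cells R d).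
Implicit Types (alpha : 'rV[R]_d -> R -> R) (phi u v : 'rV[R]_d -> R).

Definition coefficient Om alpha (Lc lambda Lambda : R) : Prop :=
  [/\ forall s, measurable_fun Om (alpha ^~ s) /\
        ('N[leb d]_(+oo)[EFin \o (alpha ^~ s \_ Om)] < +oo)%E,
      forall x s1 s2, Om x ->
        `|alpha x s1 - alpha x s2| <= Lc * `|s1 - s2|,
      forall x s (psi : 'rV[R]_d), Om x ->
        dot (alpha x s *: psi) psi >= lambda * enorm psi ^+ 2 &
      forall x s (psi : 'rV[R]_d), Om x ->
        enorm (alpha x s *: psi) <= Lambda * enorm psi].

Definition aform Om alpha D phi u v : R :=
  \int[leb d]_(x in D `&` Om)
    dot (alpha x (phi x) *: wgrad Om u x) (wgrad Om v x).

(* Q T is the operator Q^k_{phi,T}, which this determines on V_H up to null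
   sets. *)
Definition is_corrector Om alpha M I k phi
    (Q : elt M -> ('rV[R]_d -> R) -> 'rV[R]_d -> R) : Prop :=
  forall (T : elt M) v, VH Om M v ->
    Wpatch Om I k T (Q T v) /\
    forall w, Wpatch Om I k T w ->
      aform Om alpha (region (layers k T)) phi (Q T v) w =
      aform Om alpha (body T) phi v w.

Definition global_corrector M
    (Q : elt M -> ('rV[R]_d -> R) -> 'rV[R]_d -> R) v : 'rV[R]_d -> R :=
  fun x => \sum_(T : elt M) Q T v x.

(* The quotients whose maximum enters e_T.  They depend on w only through its
   restriction to T, so they are the values of a quotient of quadratic forms on a
   finite-dimensional space and their maximum is their [sup].  If no w in V_H has
   a nonzero gradient on T, the set is empty and its [sup] is 0. *)
Definition quotients Om M (Q : elt M -> ('rV[R]_d -> R) -> 'rV[R]_d -> R)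
    (T T' : elt M) : set R :=
  [set r | exists w, [/\ VH Om M w,
    ~ ae_eq (leb d) (body T `&` Om) (wgrad Om w) (cst 0) &
    r = l2norm_vec (body T' `&` Om)
          (fun x => \1_(body T) x *: wgrad Om w x - wgrad Om (Q T w) x) ^+ 2
        / semi1 Om (body T) w ^+ 2]].

Definition eT Om alpha M k (Q : elt M -> ('rV[R]_d -> R) -> 'rV[R]_d -> R)
    (xi psi : 'rV[R]_d -> R) (T : elt M) : R :=
  Num.sqrt (\sum_(T' in layers k T)
    linf_norm Om (body T') (fun x => alpha x (xi x) - alpha x (psi x)) ^+ 2 *
    sup (quotients Om Q T T')).

End correctors.

(* Main.v *)
Require Import Defs.
From mathcomp Require Import all_boot all_order all_algebra.
From mathcomp Require Import all_classical all_reals all_analysis.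
From mathcomp Require Import measurable_realfun ess_sup_inf ring lra.
Set Implicit Arguments.
Unset Strict Implicit.
Unset Printing Implicit Defensive.
Import Order.TTheory GRing.Theory Num.Theory.
Import numFieldNormedType.Exports.
Local Open Scope classical_set_scope.
Local Open Scope ring_scope.

(** Fix an element [T] and [v] in the finite element space, and let [J] be the
    difference of the weak gradients of the two element correctors of [v].
    Either corrector is an admissible test function in either corrector
    equation.  Testing both equations with the difference and subtracting them
    gives, on the patch of [T],
      [\int alpha(xi) J . J
       = \int (alpha(xi) - alpha(psi)) (chi_T grad v - grad Qpsi_T v) . J]
    ([jump_identity]).  By coercivity the left side is at least [lambda |J|^2];
    the right side is estimated element by element, the middle factor being
    controlled by the suprema that enter [eT] ([jump_estimate]).  These suprema
    are suprema of bounded sets thanks to the energy estimate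
    [corrector_energy].  For the global correctors, at almost every point only
    the jumps of at most [Col] elements are nonzero ([global_jump_estimate]), so
    that the squared norm of the sum is at most [Col] times the sum of the
    squared norms; the local estimates and the additivity of the energy of [v]
    over the elements conclude.

    Three points in this argument are not algebra.

    First, [wgrad] selects an arbitrary weak gradient.  That the gradient of a
    difference is the difference of the gradients, and that the gradient of a
    corrector vanishes off its patch, rests on the uniqueness of weak gradients
    ([is_wgrad_local]), that is on the [fundamental_lemma].  It requires smooth
    bump functions on boxes, built from [exp (- 1 / t)].

    Second, sums of integrals over closed elements are integrals over their
    union only because distinct elements overlap in a null set
    ([negligible_overlap]): they meet in the image of a facet, that is in a
    Lipschitz image of a cube of lower dimension.

    Third, the function [alpha (x, phi x)] is measurable by Lipschitz continuity
    in the second variable ([measurable_coefficient]). *)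

(** * Boxes, Borel sets and volume *)

Section boxes.
Context {R : realType} {d : nat}.
Implicit Types (c e x : 'rV[R]_d) (U A : set 'rV[R]_d).

Definition obox c e := [set x : 'rV[R]_d | forall i, c ord0 i < x ord0 i < e ord0 i].
Definition cbox c e := [set x : 'rV[R]_d | forall i, c ord0 i <= x ord0 i <= e ord0 i].

Lemma subset_obox_cbox c e : obox c e `<=` cbox c e.
Proof. by move=> x h i; have /andP[/ltW -> /ltW ->] := h i. Qed.

Lemma measurable_coord_itv i (I : interval R) :
  measurable [set x : 'rV[R]_d | x ord0 i \in I].
Proof.
rewrite -[X in measurable X]setTI.
exact: (@measurable_coord R d i measurableT [set` I] (measurable_itv I)).
Qed.

Lemma measurable_obox c e : measurable (obox c e).
Proof.
rewrite (_ : obox c e = \bigcap_(i : 'I_d)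
    [set x : 'rV[R]_d | x ord0 i \in `]c ord0 i, e ord0 i[]).
  by apply: fin_bigcap_measurable => // i _; exact: measurable_coord_itv.
by apply/seteqP; split => x h i; [move=> _|]; have := h i; rewrite /= in_itv //=; apply.
Qed.

Lemma measurable_cbox c e : measurable (cbox c e).
Proof.
rewrite (_ : cbox c e = \bigcap_(i : 'I_d)
    [set x : 'rV[R]_d | x ord0 i \in `[c ord0 i, e ord0 i]]).
  by apply: fin_bigcap_measurable => // i _; exact: measurable_coord_itv.
by apply/seteqP; split => x h i; [move=> _|]; have := h i; rewrite /= in_itv //=; apply.
Qed.

Lemma open_coord i (B : set R) : open B -> open [set x : 'rV[R]_d | B (x ord0 i)].
Proof.
move=> oB; apply: (@open_comp _ _ (fun x : 'rV[R]_d => x ord0 i)) => // x _.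
exact: coord_continuous.
Qed.

Lemma closed_coord i (B : set R) :
  closed B -> closed [set x : 'rV[R]_d | B (x ord0 i)].
Proof.
move=> cB; apply: (@closed_comp _ _ (fun x : 'rV[R]_d => x ord0 i)) => // x _.
exact: coord_continuous.
Qed.

Lemma open_obox c e : open (obox c e).
Proof.
rewrite (_ : obox c e = \big[setI/setT]_(i < d)
    [set x : 'rV[R]_d | x ord0 i \in `]c ord0 i, e ord0 i[]).
  elim/big_ind: _ => [||i _]; [exact: openT|exact: openI|].
  by apply: (@open_coord i [set` `]c ord0 i, e ord0 i[]); exact: itv_open.
rewrite -bigcap_seq; apply/seteqP; split => x h i; [move=> _|];
  have := h i; rewrite /= ?in_itv //=; apply.
by rewrite mem_index_enum.
Qed.

Lemma closed_cbox c e : closed (cbox c e).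
Proof.
rewrite (_ : cbox c e = \bigcap_(i : 'I_d)
    [set x : 'rV[R]_d | x ord0 i \in `[c ord0 i, e ord0 i]]).
  apply: closed_bigI => i _.
  by apply: (@closed_coord i [set` `[c ord0 i, e ord0 i]]); exact: itv_closed.
by apply/seteqP; split => x h i; [move=> _|]; have := h i; rewrite /= ?in_itv //=; apply.
Qed.

Lemma compact_cbox c e : compact (cbox c e).
Proof.
have := @rV_compact R d (fun i => `[c ord0 i, e ord0 i]%classic) (fun=> @segment_compact _ _ _).
congr compact; apply/seteqP; split => x h i; have := h i; by rewrite /= in_itv.
Qed.

Lemma nbhs_cbox U x : open U -> U x ->
  exists r : R, 0 < r /\ cbox (x - const_mx r) (x + const_mx r) `<=` U.
Proof.
move=> oU Ux; have /nbhs_ballP[r /= r0 rU] := open_nbhs_nbhs (conj oU Ux).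
exists (r / 2); split; first by rewrite divr_gt0.
move=> y yx; apply: rU; split => // i j; rewrite ord1.
have := yx j; rewrite !mxE /ball/= => /andP[h1 h2].
by rewrite ltr_distl; apply/andP; split; lra.
Qed.

(** A countable base of the topology, as a sequence: it turns unions over all
    open boxes into countable ones, in [open_measurable_rV] and in
    [negligible_local]. *)
Definition ratbox (n : nat) : set 'rV[R]_d :=
  if unpickle n is Some (p, q)
  then obox (map_mx (@ratr R) p) (map_mx (@ratr R) (q : 'rV[rat]_d)) else set0.

Lemma measurable_ratbox n : measurable (ratbox n).
Proof. by rewrite /ratbox; case: unpickle => // -[p q]; exact: measurable_obox. Qed.

Lemma ratboxP U x : open U -> U x -> exists n, ratbox n x /\ ratbox n `<=` U.
Proof.
move=> oU Ux; have [r [r0 rU]] := nbhs_cbox oU Ux.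
have /choice[p hp] : forall i, exists p, x ord0 i - r < ratr p < x ord0 i.
  move=> i; have [|p] := @rat_in_itvoo R (x ord0 i - r) (x ord0 i); first by rewrite ltrBlDr ltrDl.
  by rewrite in_itv/=; exists p.
have /choice[q hq] : forall i, exists q, x ord0 i < ratr q < x ord0 i + r.
  move=> i; have [|q] := @rat_in_itvoo R (x ord0 i) (x ord0 i + r); first by rewrite ltrDl.
  by rewrite in_itv/=; exists q.
exists (pickle (\row_i p i, \row_i q i)); rewrite /ratbox pickleK; split.
  by move=> i; rewrite !mxE; have /andP[_ ->] := hp i; have /andP[->] := hq i.
move=> y hy; apply: rU => i; move: (hy i); rewrite !mxE.
have /andP[h1 h2] := hp i; have /andP[h3 h4] := hq i => /andP[h5 h6].
by rewrite (ltW (lt_trans h1 h5)) (ltW (lt_trans h6 h4)).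
Qed.

(** The measurable sets are defined by the coordinates, so this uses the
    countable base. *)
Lemma open_measurable_rV U : open U -> measurable U.
Proof.
move=> oU; rewrite (_ : U = \bigcup_(n in [set n | ratbox n `<=` U]) ratbox n).
  by apply: bigcup_measurable => n _; exact: measurable_ratbox.
apply/seteqP; split=> [x Ux|x [n /= nU]]; last exact: nU.
by have [n [nx nU]] := ratboxP oU Ux; exists n.
Qed.

Lemma closed_measurable_rV U : closed U -> measurable U.
Proof.
move=> cU; rewrite -[X in measurable X]setCK; apply: measurableC.
by apply: open_measurable_rV; rewrite openC.
Qed.

Lemma continuous_measurable_rV (f : 'rV[R]_d -> R) :
  continuous f -> measurable_fun setT f.
Proof.
move=> cf; apply: (measurability _ (RGenOInfty.measurableE R)) => //.
move=> _ [_ [a ->] <-].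
rewrite setTI; apply: open_measurable_rV; apply: open_comp => //= x _; exact: cf.
Qed.

(** Null sets are stable under countable unions only; the countable base
    reduces an arbitrary cover by null pieces to a countable one.  Almost
    everywhere statements may thus be proved locally. *)
Lemma negligible_local (m : {measure set 'rV[R]_d -> \bar R}) A :
  (forall x, A x -> exists U, [/\ open U, U x & m.-negligible (U `&` A)]) ->
  m.-negligible A.
Proof.
move=> h; pose F n := ratbox n `&` [set x | A x /\ m.-negligible (ratbox n `&` A)].
have : m.-negligible (\bigcup_n F n).
  apply: negligible_bigcup => n; rewrite /F.
  have [hn|hn] := pselect (m.-negligible (ratbox n `&` A)).
    by apply: negligibleS hn => x [nx [Ax _]].
  by rewrite (_ : _ `&` _ = set0) -?subset0 //=; [exact: negligible_set0|move=> x [_ []]].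
apply: negligibleS => x Ax; have [U [oU Ux nU]] := h x Ax.
have [n [nx nU']] := ratboxP oU Ux; exists n => //; split=> //; split=> //.
by apply: negligibleS nU => y [ny Ay]; split => //; exact: nU'.
Qed.

End boxes.

Section box_volume.
Context {R : realType}.

Lemma leb_cbox d (c e : 'rV[R]_d) : (forall i, c ord0 i <= e ord0 i) ->
  leb d (cbox c e) = (\prod_i (e ord0 i - c ord0 i))%:E.
Proof.
elim: d c e => [|d IH] c e ce /=.
  rewrite big_ord0 diracE mem_set //=; by case.
rewrite /rVcons_measure /pushforward.
pose t (a : 'rV[R]_d.+1) : 'rV[R]_d := \row_j a ord0 (lift ord0 j).
rewrite (_ : _ @^-1` _ = `[c ord0 ord0, e ord0 ord0]%classic `*` cbox (t c) (t e)).
  rewrite product_measure1E//; last exact: measurable_cbox.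
  rewrite [X in (X * _)%E](lebesgue_measure_itv `[c ord0 ord0, e ord0 ord0]) /= lte_fin.
  rewrite big_ord_recl IH; last by move=> i; rewrite !mxE.
  under [in RHS]eq_bigr => i _ do idtac.
  rewrite EFinM; congr (_ * _)%E.
    have := ce ord0; rewrite le_eqVlt => /predU1P[->|->]; last by rewrite EFinB.
    by rewrite ltxx subrr.
  by congr EFin; apply: eq_bigr => i _; rewrite !mxE.
apply/seteqP; split=> [[s x] /= h|[s x] /= [h1 h2] i].
  split; first by have := h ord0; rewrite !mxE unlift_none in_itv.
  by move=> i; have := h (lift ord0 i); rewrite !mxE liftK.
rewrite !mxE; case: (unliftP ord0 i) => [j|] -> /=; last by move: h1; rewrite in_itv.
by have := h2 j; rewrite !mxE.
Qed.

Lemma bounded_sub_cbox d (A : set 'rV[R]_d) : bounded_set A ->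
  exists2 r : R, 0 < r & A `<=` cbox (const_mx (- r)) (const_mx r).
Proof.
move=> [M [_ bM]]; exists (`|M| + 1) => [|x Ax i]; first by rewrite ltr_pwDr.
have h : `|x| <= `|M| + 1 by apply: bM => //; rewrite ltr_pwDr ?ler_norm.
rewrite !mxE -ler_norml; apply: le_trans h.
rewrite [leRHS]/Num.Def.normr/= mx_normrE.
exact: (le_bigmax _ (fun j : 'I_1 * 'I_d => `|x j.1 j.2|) (ord0, i)).
Qed.

Lemma leb_bounded d (A : set 'rV[R]_d) : measurable A -> bounded_set A ->
  (leb d A < +oo)%E.
Proof.
move=> mA /bounded_sub_cbox[r r0 Ar].
apply: (@le_lt_trans _ _ (leb d (cbox (const_mx (- r)) (const_mx r)))).
  by apply: le_measure => //; rewrite inE//; exact: measurable_cbox.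
rewrite leb_cbox ?ltry// => i; rewrite !mxE; lra.
Qed.

End box_volume.

(** * Smooth bump functions *)

Section smooth_line.
Context {R : realType}.

(** Functions with [n] derivatives, given with their derivatives: closure under
    sums, products and affine changes of variable is then an induction on [n]
    that never names an iterated derivative. *)
Fixpoint smooth1 n (f : R -> R) : Prop :=
  if n is m.+1 then
    exists f' : R -> R, (forall x : R, is_derive x (1 : R) f (f' x)) /\ smooth1 m f'
  else continuous f.

Lemma smooth1_continuous n f : smooth1 n f -> continuous f.
Proof.
case: n => [//|n] [f' [df _]] x.
by apply: differentiable_continuous; apply/derivable1_diffP; case: (df x).
Qed.

Lemma smooth1W n f : smooth1 n.+1 f -> smooth1 n f.
Proof.
elim: n f => [|n IH] f; first by move=> h; exact: (@smooth1_continuous 1).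
by move=> [f' [df sf]]; exists f'; split => //; exact: IH.
Qed.

Lemma smooth1D n f g : smooth1 n f -> smooth1 n g -> smooth1 n (f \+ g).
Proof.
elim: n f g => [|n IH] f g /=; first by move=> cf cg x; apply: cvgD; [exact: cf|exact: cg].
move=> [f' [df sf]] [g' [dg sg]]; exists (f' \+ g'); split; last exact: IH.
by move=> x; exact: is_deriveD.
Qed.

Lemma smooth1M n f g : smooth1 n f -> smooth1 n g -> smooth1 n (f \* g).
Proof.
elim: n f g => [|n IH] f g /=; first by move=> cf cg x; apply: cvgM; [exact: cf|exact: cg].
move=> hf hg; have [f' [df sf]] := hf; have [g' [dg sg]] := hg.
exists ((f \* g') \+ (g \* f')); split.
  by move=> x; exact: is_deriveM.
by apply: smooth1D; apply: IH => //; exact: smooth1W.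
Qed.

Lemma smooth1_cst n (k : R) : smooth1 n (cst k).
Proof.
elim: n k => [|n IH] k; first by move=> x; exact: cvg_cst.
by exists (cst 0); split; [move=> x; exact: is_derive_cst|exact: IH].
Qed.

Lemma smooth1_affine n f (a b : R) : smooth1 n f -> smooth1 n (fun t => f (a * t + b)).
Proof.
elim: n f => [|n IH] f /=.
  move=> cf x; apply: (@continuous_comp _ _ _ (fun t => a * t + b) f); last exact: cf.
  by apply: cvgD; [apply: cvgM; [exact: cvg_cst|exact: cvg_id]|exact: cvg_cst].
move=> [f' [df sf]]; exists (fun t => f' (a * t + b) * a); split.
  move=> x; apply: is_derive1_comp.
  have -> : (fun t => a * t + b) = (a \*: (@idfun R)) \+ cst b by [].
  apply: is_derive_eq; by rewrite addr0 /GRing.scale/= mulr1.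
by apply: (@smooth1M n (fun t => f' (a * t + b)) (cst a)); [exact: IH|exact: smooth1_cst].
Qed.

(** The derivative of [flat m] is a combination of [flat m.+1] and [flat m.+2],
    so all of them are smooth, in particular the function [flat 0], which
    vanishes exactly on the nonpositive half-line. *)
Definition flat m (t : R) : R := if 0 < t then t^-1 ^+ m * expR (- t^-1) else 0.

Lemma flat_ge0 m t : 0 <= flat m t.
Proof.
by rewrite /flat; case: ifP => // t0; rewrite mulr_ge0 ?expR_ge0// exprn_ge0// invr_ge0 ltW.
Qed.

(** The exponential series at [1 / t] dominates its term of degree [m + 2].
    The quadratic bound makes every [flat m] differentiable at [0]. *)
Lemma flat_le m t : flat m t <= (m.+2)`!%:R * t ^+ 2.
Proof.
rewrite /flat; case: ifPn => [t0|_]; last by rewrite mulr_ge0// sqr_ge0.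
set u := t^-1; have u0 : 0 < u by rewrite invr_gt0.
have := expR_ge1Dxn m.+1 (ltW u0); set F : R := m.+2`!%:R => h.
have F0 : 0 < F by rewrite ltr0n fact_gt0.
rewrite expRN ler_pdivrMr ?expR_gt0//.
have -> : t ^+ 2 = u ^- 2 by rewrite /u exprVn invrK.
rewrite -mulrA mulrCA -ler_pdivrMl ?exprn_gt0 ?invr_gt0 ?exprn_gt0//.
rewrite -ler_pdivrMl ?invrK; last by rewrite ?exprn_gt0.
apply: le_trans h; rewrite -[leLHS]add0r lerD//.
by rewrite -exprD mulrC.
Qed.

Lemma flat0_le1 t : flat 0 t <= 1.
Proof.
rewrite /flat; case: ifP => // t0; rewrite expr0 mul1r -expR0 ler_expR oppr_le0.
by rewrite invr_ge0 ltW.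
Qed.

Lemma is_derive_flat m (t : R) :
  is_derive t (1 : R) (flat m) (- m%:R * flat m.+1 t + flat m.+2 t).
Proof.
have [t0|t0|t0] := ltgtP 0 t.
- have t0' : t != 0 by rewrite gt_eqF.
  apply: (@near_eq_is_derive R R R
    (((fun s : R => s^-1) ^+ m) \* (expR \o (fun s : R => - s^-1)))).
    near=> s; rewrite /= fctE /flat ifT//; near: s; exact: lt_nbhsr.
  have d1 : is_derive t (1 : R) (fun s : R => s^-1) (- t ^- 2 *: (1 : R)).
    exact: (@is_deriveV _ id).
  have d2 := @is_derive1_comp R expR (fun s : R => - s^-1) t _ _
    (is_derive_expR (- t^-1)) (is_deriveN d1).
  apply: (is_derive_eq (is_deriveM (is_deriveX m d1) d2)).
  rewrite /flat t0 /GRing.scale /= fctE !mulr1 !mulrN opprK.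
  rewrite -!exprVn; set u := t^-1; set e := expR _.
  have -> : u ^+ m.+2 = u ^+ m * u ^+ 2 by rewrite -exprD addn2.
  case: (m) => [|n] /=; first by rewrite !expr0; ring.
  have -> : u ^+ n.+2 = u ^+ n * u ^+ 2 by rewrite -exprD addn2.
  by rewrite exprS; ring.
- apply: (@near_eq_is_derive R R R (cst (0 : R))).
    near=> s; rewrite /flat ifF//; apply/negbTE; rewrite -leNgt ltW//; near: s; exact: lt_nbhsl.
  by rewrite /flat ltNge ltW// mulr0 addr0; exact: is_derive_cst.
rewrite -t0 {2 3}/flat ltxx mulr0 addr0.
(* The difference quotient at [0] is [flat m h / h], at most a multiple of [h]. *)
have cv : h^-1 *: ((flat m \o shift 0) (h *: (1 : R)) - flat m 0) @[h --> (0 : R)^'] --> (0 : R).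
  apply/cvgrPdist_le => e e0; near=> h.
  rewrite /= sub0r normrN addr0 /GRing.scale /= mulr1 {2}/flat ltxx subr0.
  rewrite normrM normfV (ger0_norm (flat_ge0 _ _)).
  have h0 : h != 0 by near: h; exact: nbhs_dnbhs_neq.
  rewrite ler_pdivrMl ?normr_gt0//; apply: le_trans (flat_le _ _) _.
  rewrite -real_normK ?num_real// expr2 mulrA mulrC ler_pM2l ?normr_gt0//.
  rewrite -ler_pdivlMl ?ltr0n ?fact_gt0//; near: h; apply: dnbhs0_le.
  by rewrite mulr_gt0// invr_gt0 ltr0n fact_gt0.
apply: DeriveDef; first by apply/cvg_ex; exists 0.
exact: (cvg_lim _ cv).
Unshelve. all: by end_near. Qed.

Lemma smooth1_flat n m : smooth1 n (flat m).
Proof.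
elim: n m => [|n IH] m.
  by move=> t; apply: differentiable_continuous; apply/derivable1_diffP; case: (is_derive_flat m t).
exists (fun t => - m%:R * flat m.+1 t + flat m.+2 t); split; first exact: is_derive_flat.
apply: (@smooth1D n (cst (- m%:R) \* flat m.+1) (flat m.+2)) => //.
by apply: smooth1M => //; exact: smooth1_cst.
Qed.
End smooth_line.

Section smooth_space.
Context {R : realType} {d : nat}.
Implicit Types u v : 'rV[R]_d -> R.

(** The partial derivatives of order at most [n], again given together with the
    function; continuity is required separately since partial derivatives do
    not imply it. *)
Fixpoint Ck n u : Prop :=
  continuous u /\
  if n is m.+1 then forall i : 'I_d, exists u' : 'rV[R]_d -> R,
    (forall x, is_derive x (delta_mx ord0 i) u (u' x)) /\ Ck m u'
  else True.

Lemma Ck_continuous n u : Ck n u -> continuous u.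
Proof. by case: n => [|n] []. Qed.

Lemma CkW n u : Ck n.+1 u -> Ck n u.
Proof.
elim: n u => [|n IH] u; first by move=> [].
move=> [cu du]; split => // i; have [u' [h1 h2]] := du i.
by exists u'; split => //; exact: IH.
Qed.

Lemma continuous_addf u v : continuous u -> continuous v -> continuous (u \+ v).
Proof. by move=> cu cv x; exact: (@continuousD _ _ _ u v x (cu x) (cv x)). Qed.

Lemma continuous_mulf u v : continuous u -> continuous v -> continuous (u \* v).
Proof. by move=> cu cv x; exact: (@continuousM _ _ u v x (cu x) (cv x)). Qed.

Lemma CkD n u v : Ck n u -> Ck n v -> Ck n (u \+ v).
Proof.
elim: n u v => [|n IH] u v [cu du] [cv dv]; split.
- exact: continuous_addf.
- by [].
- exact: continuous_addf.
- move=> i; have [u' [hu su]] := du i; have [v' [hv sv]] := dv i.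
  exists (u' \+ v'); split; last exact: IH.
  by move=> x; exact: is_deriveD.
Qed.

Lemma CkM n u v : Ck n u -> Ck n v -> Ck n (u \* v).
Proof.
elim: n u v => [|n IH] u v hu hv.
  by split => //; apply: continuous_mulf; [exact: (Ck_continuous hu)|exact: (Ck_continuous hv)].
split; first by apply: continuous_mulf; [exact: (Ck_continuous hu)|exact: (Ck_continuous hv)].
move=> i; have [u' [du su]] := hu.2 i; have [v' [dv sv]] := hv.2 i.
exists ((u \* v') \+ (v \* u')); split; first by move=> x; exact: is_deriveM.
by apply: CkD; apply: IH => //; exact: CkW.
Qed.

Lemma Ck_cst n (k : R) : Ck n (cst k).
Proof.
elim: n k => [|n IH] k; (split; first exact: cst_continuous) => //.
by move=> i; exists (cst 0); split => // x; exact: is_derive_cst.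
Qed.

Lemma is_derive_coord (f f' : R -> R) (i j : 'I_d) (x : 'rV[R]_d) :
  (forall t : R, is_derive t (1 : R) f (f' t)) ->
  is_derive x (delta_mx ord0 j) (fun y : 'rV[R]_d => f (y ord0 i))
    ((i == j)%:R * f' (x ord0 i)).
Proof.
move=> df; have [<-|ij] := eqVneq i j.
  have E : (fun h : R => h^-1 *: (((fun y : 'rV[R]_d => f (y ord0 i)) \o shift x)
      (h *: delta_mx ord0 i) - f (x ord0 i))) =
    (fun h : R => h^-1 *: ((f \o shift (x ord0 i)) (h *: (1 : R)) - f (x ord0 i))).
    by apply/funext => h /=; rewrite !mxE eqxx /GRing.scale/= eqxx.
  have [h1 h2] := df (x ord0 i); rewrite mul1r.
  by apply: DeriveDef; [rewrite /derivable E|rewrite /derive E].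
(* Along the other axes the function is constant. *)
have E : (fun h : R => h^-1 *: (((fun y : 'rV[R]_d => f (y ord0 i)) \o shift x)
      (h *: delta_mx ord0 j) - f (x ord0 i))) =
    (fun h : R => h^-1 *: ((cst (0 : R) \o shift (0 : R)) (h *: (1 : R)) - cst (0 : R) (0 : R))).
  by apply/funext => h /=; rewrite !mxE eqxx (negbTE ij) /= mulr0 add0r !subrr.
have [h1 h2] := is_derive_cst (0 : R) (0 : R) (1 : R); rewrite mul0r.
by apply: DeriveDef; [rewrite /derivable E|rewrite /derive E].
Qed.

Lemma Ck_coord n (f : R -> R) (i : 'I_d) :
  smooth1 n f -> Ck n (fun x => f (x ord0 i)).
Proof.
have cc (g : R -> R) : continuous g -> continuous (fun x : 'rV[R]_d => g (x ord0 i)).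
  move=> cg x; apply: (@continuous_comp _ _ _ (fun x : 'rV[R]_d => x ord0 i) g); last exact: cg.
  exact: coord_continuous.
elim: n f => [|n IH] f /=; first by move=> cf; split => //; exact: cc.
move=> hf; split; first by apply: cc; exact: (@smooth1_continuous _ n.+1).
have [f' [df sf]] := hf => j; exists (fun x => (i == j)%:R * f' (x ord0 i)); split.
  by move=> x; exact: is_derive_coord.
by apply: (@CkM n (cst _) (fun x => f' (x ord0 i))); [exact: Ck_cst|exact: IH].
Qed.

Lemma Ck_prod n (I : Type) (r : seq I) (u : I -> 'rV[R]_d -> R) :
  (forall i, Ck n (u i)) -> Ck n (fun x => \prod_(i <- r) u i x).
Proof.
move=> hu; elim: r => [|i r IH].
  by rewrite (_ : (fun x => _) = cst 1); [exact: Ck_cst|apply/funext => x; rewrite big_nil].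
rewrite (_ : (fun x => _) = u i \* (fun x => \prod_(i <- r) u i x)); first exact: CkM.
by apply/funext => x; rewrite big_cons.
Qed.

Lemma Ck_smooth u : (forall n, Ck n u) -> smooth u.
Proof.
move=> hu s; have {hu} := hu (size s).+1.
elim/last_ind: s u => [|s i IH] u hu.
  split; first exact: (Ck_continuous hu).
  by move=> x i; have [u' [du _]] := hu.2 i; case: (du x).
rewrite foldr_rcons; apply: IH; rewrite size_rcons in hu.
have [u' [du su]] := hu.2 i.
by rewrite (_ : partial i u = u')//; apply/funext => x; case: (du x).
Qed.

End smooth_space.

Section box_bump.
Context {R : realType} {d : nat}.
Variables c e : 'rV[R]_d.

(** The indicator of the box is the pointwise limit of these test functions:
    integrals over boxes are limits of integrals against test functions. *)
Definition box_bump n (x : 'rV[R]_d) : R := \prod_(i < d)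
  (flat 0 (n.+1%:R * (x ord0 i - c ord0 i)) *
   flat 0 (n.+1%:R * (e ord0 i - x ord0 i))).

Lemma box_bump_smooth n : smooth (box_bump n).
Proof.
apply: Ck_smooth => k; apply: Ck_prod => i.
apply: (Ck_coord (f := fun t =>
  flat 0 (n.+1%:R * (t - c ord0 i)) * flat 0 (n.+1%:R * (e ord0 i - t)))).
apply: smooth1M.
  rewrite (_ : (fun t => _) = (fun t => flat 0 (n.+1%:R * t + - (n.+1%:R * c ord0 i)))).
    by apply: smooth1_affine; exact: smooth1_flat.
  by apply/funext => t; rewrite mulrBr.
rewrite (_ : (fun t => _) = (fun t => flat 0 (- n.+1%:R * t + n.+1%:R * e ord0 i))).
  by apply: smooth1_affine; exact: smooth1_flat.
by apply/funext => t; congr flat; ring.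
Qed.

Lemma box_bump01 n x : 0 <= box_bump n x <= 1.
Proof.
rewrite /box_bump prodr_ge0 /=; last by move=> i _; rewrite mulr_ge0// flat_ge0.
by rewrite prodr_ile1// => i _; rewrite mulr_ge0 ?flat_ge0//= mulr_ile1 ?flat_ge0 ?flat0_le1.
Qed.

Lemma box_bump_out n x : ~ obox c e x -> box_bump n x = 0.
Proof.
move=> /existsNP[i hi]; apply/eqP; rewrite prodf_seq_eq0; apply/hasP.
exists i; rewrite ?mem_index_enum//=.
rewrite mulf_eq0 /flat !pmulr_rgt0// !subr_gt0.
case: ltP; rewrite ?eqxx// => h1; case: ltP; rewrite ?eqxx ?orbT// => h2.
by exfalso; apply: hi; rewrite h1 h2.
Qed.

Lemma test_function_box_bump Om n : cbox c e `<=` Om -> test_function Om (box_bump n).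
Proof.
move=> ceOm.
have sub : closure [set x | box_bump n x != 0] `<=` cbox c e.
  rewrite (closure_id (cbox c e)).1; last exact: closed_cbox.
  apply: closureS => x /= hx; apply: subset_obox_cbox.
  by apply: contrapT => /box_bump_out h; rewrite h eqxx in hx.
split; first exact: box_bump_smooth.
- by apply: (@subclosed_compact _ _ (cbox c e)) => //; [exact: closed_closure|exact: compact_cbox].
- exact: subset_trans sub ceOm.
Qed.

Lemma box_bump_cvg x : box_bump n x @[n --> \oo] --> (\1_(obox c e) x : R).
Proof.
rewrite indicE; have [/set_mem hx|/negP hx] := boolP (x \in obox c e); last first.
  rewrite (_ : (fun n => _) = cst 0); first exact: cvg_cst.
  by apply/funext => n; rewrite box_bump_out// => /mem_set.
have fl (a : R) : 0 < a -> flat 0 (n.+1%:R * a) @[n --> \oo] --> (1 : R).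
  move=> a0.
  rewrite (_ : (fun n => _) = (fun n => expR (- a^-1 * harmonic n))).
    have h : - a^-1 * harmonic n @[n --> \oo] --> (- a^-1 * 0 : R).
      by apply: cvgM; [exact: cvg_cst|exact: cvg_harmonic].
    rewrite mulr0 in h; rewrite -expR0.
    exact: (cvg_comp _ _ h (@continuous_expR R 0)).
  apply/funext => n; rewrite /flat pmulr_rgt0// a0 expr0 mul1r invfM /harmonic/=; congr expR; ring.
have -> : true%:R = \prod_(i < d) (1 * 1) :> R by rewrite big1// => i _; rewrite mulr1.
apply: cvg_big => [|i _ /=]; first exact: mul_continuous.
 have /andP[h1 h2] := hx i.
by apply: cvgM; apply: fl; rewrite subr_gt0.
Qed.

End box_bump.

(** * Square integrable functions *)

Section square_integrable.
Context {R : realType} {d : nat}.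
Implicit Types (D E U : set 'rV[R]_d) (u v : 'rV[R]_d -> R).
Local Notation mu := (leb d : {measure set 'rV[R]_d -> \bar R}).

Lemma L2_sqr_integrable D u : L2 D u -> mu.-integrable D (EFin \o (fun x => u x ^+ 2)).
Proof.
move=> [mu_ fu]; apply/integrableP; split.
  by apply/measurable_EFinP; exact: measurable_funX.
by under eq_integral => x _ do rewrite /= ger0_norm ?sqr_ge0//.
Qed.

Lemma L2_of_le D u v : measurable D -> measurable_fun D u ->
  mu.-integrable D (EFin \o v) -> (forall x, D x -> u x ^+ 2 <= v x) -> L2 D u.
Proof.
move=> mD mu_ iv uv; split=> //.
apply: le_lt_trans (integrableP _ _ _ iv).2.
apply: ge0_le_integral => //=.
- by move=> x Dx; rewrite lee_fin sqr_ge0.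
- by apply/measurable_EFinP; exact: measurable_funX.
- apply/measurable_EFinP; apply: measurableT_comp => //.
  by apply/measurable_EFinP; exact: measurable_int iv.
by move=> x Dx; rewrite lee_fin (le_trans (uv _ Dx))// ler_norm.
Qed.

Lemma L2_mul_integrable D u v : measurable D -> L2 D u -> L2 D v ->
  mu.-integrable D (EFin \o (fun x => u x * v x)).
Proof.
move=> mD hu hv.
apply: (le_integrable mD _ _ (integrableD mD (L2_sqr_integrable hu) (L2_sqr_integrable hv))).
  by apply/measurable_EFinP; apply: measurable_funM; [case: hu|case: hv].
move=> x Dx /=; rewrite lee_fin normrM [leRHS]ger0_norm; last by rewrite addr_ge0 ?sqr_ge0.
by rewrite -[u x ^+ 2]real_normK ?num_real// -[v x ^+ 2]real_normK ?num_real//; nra.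
Qed.

Lemma L2_mul_bounded D u v (K : R) : measurable D -> measurable_fun D v ->
  (forall x, D x -> `|v x| <= K) -> L2 D u -> L2 D (fun x => v x * u x).
Proof.
move=> mD mv vK hu.
apply: (@L2_of_le D _ (fun x => K ^+ 2 * u x ^+ 2)) => //.
- by apply: measurable_funM => //; case: hu.
- have := integrableZl mD (K ^+ 2) (L2_sqr_integrable hu); congr (_.-integrable _ _).
- move=> x Dx; rewrite exprMn ler_wpM2r ?sqr_ge0// -[v x ^+ 2]real_normK ?num_real//.
  by rewrite lerXn2r ?nnegrE// ?(vK _ Dx) ?(le_trans _ (vK _ Dx)).
Qed.

Lemma L2Z D u (a : R) : measurable D -> L2 D u -> L2 D (fun x => a * u x).
Proof. by move=> mD; exact: (@L2_mul_bounded D u (cst a) `|a|). Qed.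

Lemma L2D D u v : measurable D -> L2 D u -> L2 D v -> L2 D (fun x => u x + v x).
Proof.
move=> mD hu hv.
apply: (@L2_of_le D _ (fun x => (2 * u x ^+ 2) + (2 * v x ^+ 2))) => //.
- by apply: measurable_funD; [case: hu|case: hv].
- have := integrableD mD (integrableZl mD 2 (L2_sqr_integrable hu))
    (integrableZl mD 2 (L2_sqr_integrable hv)).
  by congr (_.-integrable _ _).
- by move=> x _; have := sqr_ge0 (u x - v x); nra.
Qed.

Lemma L2B D u v : measurable D -> L2 D u -> L2 D v -> L2 D (u \- v).
Proof.
move=> mD hu hv; rewrite (_ : _ \- _ = fun x => -1 * v x + u x).
  by apply: L2D => //; exact: L2Z.
by apply/funext => x /=; ring.
Qed.

Lemma L2_0 D : measurable D -> L2 D (cst 0).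
Proof.
move=> mD; apply: (@L2_of_le D _ (cst 0)) => //; first exact: integrable0.
by move=> x _ /=; rewrite expr0n.
Qed.

Lemma L2_sum D (I : Type) (r : seq I) (P : pred I) (u : I -> 'rV[R]_d -> R) : measurable D ->
  (forall i, P i -> L2 D (u i)) -> L2 D (fun x => \sum_(i <- r | P i) u i x).
Proof.
move=> mD hu; elim: r => [|i r IH].
  by rewrite (_ : (fun x => _) = cst 0); [exact: L2_0|apply/funext => x; rewrite big_nil].
have [Pi|Pi] := boolP (P i).
  rewrite (_ : (fun x => _) = (fun x => u i x + \sum_(i <- r | P i) u i x)).
    by apply: L2D => //; exact: hu.
  by apply/funext => x; rewrite big_cons Pi.
rewrite (_ : (fun x => _) = (fun x => \sum_(i <- r | P i) u i x))//.
by apply/funext => x; rewrite big_cons (negbTE Pi).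
Qed.

Lemma L2S D E u : measurable D -> measurable E -> E `<=` D -> L2 D u -> L2 E u.
Proof.
move=> mD mE ED hu; have := integrableS mD mE ED (L2_sqr_integrable hu).
move=> h; split; first by apply: measurable_funS mD ED _; case: hu.
have := (integrableP _ _ _ h).2.
by under eq_integral => x _ do rewrite /= ger0_norm ?sqr_ge0//.
Qed.

Lemma L2_bounded D u (K : R) : measurable D -> (mu D < +oo)%E ->
  measurable_fun D u -> (forall x, D x -> `|u x| <= K) -> L2 D u.
Proof.
move=> mD fD mu_ uK; apply: (@L2_of_le D _ (cst (K ^+ 2))) => //.
  apply: measurable_bounded_integrable => //.
  by exists `|K ^+ 2|; split; rewrite ?num_real// => y hy x Dx /=; rewrite ltW.
move=> x Dx /=; rewrite -[u x ^+ 2]real_normK ?num_real// lerXn2r ?nnegrE//.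
  by rewrite (le_trans _ (uK _ Dx)).
exact: uK.
Qed.

Lemma L2_integrable D u : measurable D -> (mu D < +oo)%E -> L2 D u ->
  mu.-integrable D (EFin \o u).
Proof.
move=> mD fD hu.
have h1 : L2 D (cst 1) by apply: (@L2_bounded _ _ 1) => // x _ /=; rewrite normr1.
apply: eq_integrable (L2_mul_integrable mD hu h1) => // x _ /=.
by rewrite mulr1.
Qed.

Lemma integral_support D E (f : 'rV[R]_d -> \bar R) : E `<=` D ->
  (forall x, D x -> ~ E x -> f x = 0%E) ->
  (\int[mu]_(x in D) f x = \int[mu]_(x in E) f x)%E.
Proof.
move=> ED f0; rewrite integral_mkcond [RHS]integral_mkcond; apply: eq_integral => x _.
rewrite !patchE; case: ifPn => xD; case: ifPn => xE //.
  by apply: f0; [exact: set_mem|move=> /mem_set; exact/negP].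
by exfalso; move/negP: xD; apply; apply/mem_set/ED/set_mem.
Qed.

Lemma Rintegral_support D E u : E `<=` D ->
  (forall x, D x -> ~ E x -> u x = 0) ->
  \int[mu]_(x in D) u x = \int[mu]_(x in E) u x.
Proof.
by move=> ED u0; congr fine; apply: integral_support => // x Dx Ex; rewrite u0.
Qed.

(** A continuous function with compact support is bounded and lives on a set
    of finite measure. *)
Lemma L2_continuous_compact D K u : measurable D -> compact K ->
  continuous u -> (forall x, ~ K x -> u x = 0) -> L2 D u.
Proof.
move=> mD cK cu u0.
have mu_ : measurable_fun setT u := continuous_measurable_rV cu.
have cl : closed K by apply: compact_closed => //; exact: Rhausdorff.
have mK := closed_measurable_rV cl.
have fK := leb_bounded mK (compact_bounded cK).
have [M [_ hM]] : bounded_set (u @` K).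
  by apply: compact_bounded; apply: continuous_compact => //; exact: continuous_subspaceT.
have uM x : K x -> `|u x| <= `|M| + 1.
  move=> Kx; apply: (hM (`|M| + 1)); last by exists x.
  by rewrite ltr_pwDr// ler_norm.
have h := L2_bounded mK fK (measurable_funS measurableT (@subsetT _ K) mu_) uM.
apply: (L2S measurableT mD) => //; split => //.
rewrite (@integral_support setT K)//; first by case: h.
by move=> x _ /u0 ->; rewrite expr0n.
Qed.

Lemma L2_test D Om phi : measurable D -> test_function Om phi -> L2 D phi.
Proof.
move=> mD [sphi cphi _]; apply: (L2_continuous_compact mD cphi).
  by have [] := sphi [::].
by move=> x; apply: contra_notP => /eqP h; exact: subset_closure.
Qed.

Lemma partial_test_out (Om : set 'rV[R]_d) phi i (x : 'rV[R]_d) : test_function Om phi ->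
  ~ Om x -> partial i phi x = 0.
Proof.
move=> [_ _ sphi] nx; have {}nx : ~ closure [set x | phi x != 0] x by move=> /sphi.
rewrite /partial (near_eq_derive (g := cst 0)); first exact: derive_cst.
near=> y; apply: contrapT => /eqP h.
have : (~` closure [set x | phi x != 0]) y.
  near: y; apply: open_nbhs_nbhs; split => //.
  by rewrite openC; exact: closed_closure.
by apply; exact: subset_closure.
Unshelve. all: by end_near. Qed.

Lemma L2_partial_test D Om phi i : measurable D -> test_function Om phi ->
  L2 D (partial i phi).
Proof.
move=> mD [sphi cphi _]; apply: (L2_continuous_compact mD cphi).
  by have [] := sphi [:: i].
move=> x hx; by apply: (@partial_test_out (closure [set x | phi x != 0])) => //; split.
Qed.

End square_integrable.

(** * The fundamental lemma of the calculus of variations *)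

Section fundamental_lemma.
Context {R : realType} {d : nat}.
Implicit Types (D E U : set 'rV[R]_d) (u v : 'rV[R]_d -> R).
Local Notation mu := (leb d : {measure set 'rV[R]_d -> \bar R}).

Lemma leb_obox_lty (c e : 'rV[R]_d) : (mu (obox c e) < +oo)%E.
Proof.
apply: le_lt_trans (leb_bounded (measurable_cbox c e) (compact_bounded (@compact_cbox _ _ c e))).
apply: le_measure; rewrite ?inE; [exact: measurable_obox|exact: measurable_cbox|].
exact: subset_obox_cbox.
Qed.

(** Orthants rather than boxes: they are stable under intersection, and the
    trace of an orthant on a box is again a box. *)
Definition orthant (a : 'rV[R]_d) : set 'rV[R]_d := [set x | forall i, a ord0 i < x ord0 i].

Lemma measurable_orthants :
  @measurable _ 'rV[R]_d = <<s [set orthant a | a in setT] >>.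
Proof.
apply/seteqP; split; last first.
  apply: smallest_sub; first exact: sigma_algebra_measurable.
  move=> _ [a _ <-]; rewrite (_ : orthant a = \bigcap_(i : 'I_d)
    [set x : 'rV[R]_d | x ord0 i \in `]a ord0 i, +oo[]).
    by apply: fin_bigcap_measurable => // i _; exact: measurable_coord_itv.
  by apply/seteqP; split => x h i; [move=> _|]; have := h i; rewrite /= in_itv /= andbT //; apply.
apply: smallest_sub; first exact: smallest_sigma_algebra.
rewrite -bigcup_seq; apply: bigcup_sub => i _ _ [B mB <-] /=; rewrite setTI.
have {}mB : (@RGenOInfty.G R).-sigma.-measurable B by rewrite -RGenOInfty.measurableE.
have sB := smallest_sub _ _ mB.
apply: (sB ([set B | <<s [set orthant a | a in setT] >> ((fun x : 'rV[R]_d => x ord0 i) @^-1` B)])).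
  split.
  - by rewrite /= preimage_set0; exact: sigma_algebra0.
  - by move=> C hC /=; rewrite setTD preimage_setC; exact: sigma_algebraC.
  - by move=> F hF /=; rewrite preimage_bigcup; exact: sigma_algebra_bigcup.
move=> _ [r ->] /=.
rewrite (_ : _ @^-1` _ = \bigcup_n orthant (\row_j (if j == i then r else - n%:R))).
  by apply: sigma_algebra_bigcup => n; apply: sub_sigma_algebra; eexists.
apply/seteqP; split=> [x|x [n _]] /=; rewrite in_itv/= andbT; last first.
  by move=> /(_ i); rewrite mxE eqxx.
move=> rx; pose K := \sum_(j < d) `|x ord0 j|.
have [n hn] : exists n : nat, K < n%:R.
  by exists (Num.bound K); apply: archi_boundP; exact: sumr_ge0.
exists n => // j; rewrite mxE; case: eqP => [->//|_].
rewrite ltrNl; apply: le_lt_trans hn; rewrite /K (bigD1 j)//=.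
by rewrite (le_trans (ler_norm _))// normrN lerDl sumr_ge0.
Qed.

Lemma setI_closed_orthants : setI_closed [set orthant a | a in setT].
Proof.
move=> _ _ [a _ <-] [b _ <-]; exists (\row_i Num.max (a ord0 i) (b ord0 i)) => //.
apply/seteqP; split => x.
  by move=> h; split => i; have := h i; rewrite mxE gt_max => /andP[].
by move=> [h1 h2] i; rewrite mxE gt_max h1 h2.
Qed.

(** The bumps of the box are admissible test functions, and they converge to
    its indicator, dominated by [1]. *)
Lemma integral_box0 U u (c e : 'rV[R]_d) : open U -> L2 U u ->
  (forall phi, test_function U phi -> \int[mu]_(x in U) (u x * phi x) = 0) ->
  cbox c e `<=` U -> (\int[mu]_(x in obox c e) (u x)%:E = 0)%E.
Proof.
move=> oU hu u0 ceU; have mB := measurable_obox c e.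
have mU := open_measurable_rV oU.
have BU : obox c e `<=` U := subset_trans (@subset_obox_cbox _ _ c e) ceU.
have fB : (mu (obox c e) < +oo)%E.
  exact: leb_obox_lty.
have hB := L2S mU mB BU hu.
have iB : mu.-integrable (obox c e) (EFin \o u).
  exact: L2_integrable.
have mphi n : measurable_fun setT (box_bump c e n).
  by apply: continuous_measurable_rV; have [] := box_bump_smooth c e n [::].
have zero n : (\int[mu]_(x in obox c e) (u x * box_bump c e n x)%:E = 0)%E.
  have tf := test_function_box_bump n ceU.
  have int := L2_mul_integrable mU hu (L2_test mU tf).
  have := u0 _ tf; rewrite /Rintegral => h.
  rewrite -(integral_support BU).
    by rewrite -[LHS]fineK ?h//; exact: integrable_fin_num int.
  by move=> x _ hx; rewrite box_bump_out// mulr0.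
have [] := @dominated_convergence _ _ _ mu (obox c e) mB
  (fun n x => (u x * box_bump c e n x)%:E) (EFin \o u) (abse \o (EFin \o u)).
- move=> n; apply/measurable_EFinP; apply: measurable_funM; first by case: hB.
  exact: measurable_funS measurableT (@subsetT _ _) (mphi n).
- exact: measurable_int iB.
- apply: aeW => x Bx; apply: cvg_EFin; first by apply: nearW.
  have h := @box_bump_cvg _ _ c e x; rewrite indicE mem_set// in h.
  rewrite -[X in _ --> X]mulr1.
  by apply: cvgM; [exact: cvg_cst|exact: h].
- exact: integrable_abse.
- apply: aeW => x n Bx /=; rewrite lee_fin normrM ler_piMr// ger0_norm.
    by have /andP[] := box_bump01 c e n x.
  by have /andP[] := box_bump01 c e n x.
move=> _ _; under eq_fun => n do rewrite zero.
by move=> h; apply/esym; apply: (cvg_unique _ _ h); [exact: ereal_hausdorff|exact: cvg_cst].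
Qed.

(** By [negligible_local] it suffices to work in a small box.  There the sets
    over which [u] has integral zero form a Dynkin system; it contains the
    traces of the orthants, which generate the measurable sets. *)
Lemma fundamental_lemma U u : open U -> L2 U u ->
  (forall phi, test_function U phi -> \int[mu]_(x in U) (u x * phi x) = 0) ->
  ae_eq mu U u (cst 0).
Proof.
move=> oU hu u0; have mU := open_measurable_rV oU.
apply: negligible_local => x /not_implyP[Ux _].
have [r [r0 ceU]] := nbhs_cbox oU Ux.
set c := x - _ in ceU; set e := x + _ in ceU.
have mB := measurable_obox c e.
have BU : obox c e `<=` U := subset_trans (@subset_obox_cbox _ _ c e) ceU.
have fB : (mu (obox c e) < +oo)%E.
  exact: leb_obox_lty.
have hB := L2S mU mB BU hu.
have iB : mu.-integrable (obox c e) (EFin \o u).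
  exact: L2_integrable.
exists (obox c e); split; [exact: open_obox| |].
  by move=> i; rewrite !mxE; apply/andP; split; lra.
have : ae_eq mu (obox c e) (EFin \o u) (cst 0%E).
  apply: integral_ae_eq => // E EB mE; rewrite integral0.
  have sE : <<s [set orthant a | a in setT] >> E by rewrite -measurable_orthants.
  rewrite -[E](setIidl EB).
  apply: (dynkin_induction
    (P := fun E => (\int[mu]_(x in E `&` obox c e) (EFin \o u) x = 0)%E)
    measurable_orthants setI_closed_orthants _ _ _ _ sE) => {E EB mE sE}.
  - by rewrite setTI; exact: (integral_box0 oU hu u0 ceU).
  - move=> _ [a _ <-].
    rewrite (_ : _ `&` _ = obox (\row_i Num.max (a ord0 i) (c ord0 i)) e).
      apply: (integral_box0 oU hu u0); apply: subset_trans ceU => y hy i.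
      by have := hy i; rewrite mxE ge_max => /andP[/andP[_ ->] ->].
    apply/seteqP; split => y.
      by move=> [h1 h2] i; rewrite mxE gt_max h1; have := h2 i.
    move=> h; split => i; have := h i; rewrite mxE gt_max => /andP[/andP[]] //.
    by move=> _ -> ->.
  - move=> S mS S0.
    have := @integral_setU _ _ _ mu (S `&` obox c e) (~` S `&` obox c e) (EFin \o u).
    rewrite -setIUl setUv setTI (integral_box0 oU hu u0 ceU) S0 add0e => <- //.
    + exact: measurableI.
    + by apply: measurableI => //; exact: measurableC.
    + exact: measurable_int iB.
    + by rewrite disj_set2E; apply/eqP; apply/seteqP; split => // y [[? _] [? _]].
  - move=> F mF tF F0; rewrite setI_bigcupl integral_bigcup//.
    + by under eq_eseriesr => n _ do rewrite F0; rewrite eseries0.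
    + by apply: trivIset_setIr.
    + by move=> k; exact: measurableI.
    + apply: integrableS iB => //.
        rewrite -setI_bigcupl; apply: measurableI => //.
        exact: bigcup_measurable.
      by move=> y [n _ []].
apply: negligibleS => y [yB /not_implyP[Uy hy]] /= h.
by apply: hy; have [] := h yB.
Qed.

End fundamental_lemma.

(** * The inner product of square integrable fields *)

(** The form in which both Cauchy--Schwarz inequalities below are proved; it
    covers the degenerate case [c = 0]. *)
Lemma discriminant_le {R : realFieldType} (a b c : R) : 0 <= a -> 0 <= c ->
  (forall t, 0 <= a - 2 * t * b + t ^+ 2 * c) -> b ^+ 2 <= a * c.
Proof.
move=> a0 c0 pos; have [c00|cn0] := eqVneq c 0.
  rewrite c00 mulr0; have [->|bn0] := eqVneq b 0; first by rewrite expr0n.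
  have := pos ((a + 1) / (2 * b)); rewrite c00 mulr0 addr0.
  rewrite (_ : 2 * _ * b = a + 1); last by field.
  by rewrite opprD addrA subrr sub0r oppr_ge0 lt_geF.
have := pos (b / c); rewrite (_ : _ + _ = (a * c - b ^+ 2) / c); last by field.
by rewrite pmulr_lge0 ?invr_gt0 ?lt_def ?cn0// subr_ge0.
Qed.

Lemma sum_CS {R : realFieldType} (I : Type) (r : seq I) (P : pred I) (x y : I -> R) :
  (\sum_(i <- r | P i) x i * y i) ^+ 2 <=
  (\sum_(i <- r | P i) x i ^+ 2) * (\sum_(i <- r | P i) y i ^+ 2).
Proof.
apply: discriminant_le; [by apply: sumr_ge0 => i _; exact: sqr_ge0..|move=> t].
rewrite !mulr_sumr -sumrB -big_split /=; apply: sumr_ge0 => i _.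
have := sqr_ge0 (x i - t * y i); congr (0 <= _); ring.
Qed.

Section inner_product.
Context {R : realType} {d : nat}.
Implicit Types (D E : set 'rV[R]_d) (u v : 'rV[R]_d -> R).
Implicit Types (F G H : 'rV[R]_d -> 'rV[R]_d).
Local Notation mu := (leb d : {measure set 'rV[R]_d -> \bar R}).

Lemma dotC (x y : 'rV[R]_d) : dot x y = dot y x.
Proof. by apply: eq_bigr => i _; rewrite mulrC. Qed.

Lemma dotDl (x y z : 'rV[R]_d) : dot (x + y) z = dot x z + dot y z.
Proof. by rewrite /dot -big_split; apply: eq_bigr => i _; rewrite mxE mulrDl. Qed.

Lemma dotZl a (x y : 'rV[R]_d) : dot (a *: x) y = a * dot x y.
Proof. by rewrite /dot mulr_sumr; apply: eq_bigr => i _; rewrite mxE mulrA. Qed.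

Lemma dotZr a (x y : 'rV[R]_d) : dot x (a *: y) = a * dot x y.
Proof. by rewrite dotC dotZl dotC. Qed.

Lemma dotBl (x y z : 'rV[R]_d) : dot (x - y) z = dot x z - dot y z.
Proof. by rewrite dotDl -scaleN1r dotZl mulN1r. Qed.

Lemma dotBr (x y z : 'rV[R]_d) : dot x (y - z) = dot x y - dot x z.
Proof. by rewrite dotC dotBl !(dotC x). Qed.

Lemma dot_ge0 (x : 'rV[R]_d) : 0 <= dot x x.
Proof. by apply: sumr_ge0 => i _; rewrite -expr2 sqr_ge0. Qed.

Lemma dotB_le2 (x y : 'rV[R]_d) :
  dot (x - y) (x - y) <= 2 * dot x x + 2 * dot y y.
Proof.
have h := dot_ge0 (x + y); rewrite dotDl !(dotC _ (x + y)) !dotDl in h.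
by rewrite dotBl !dotBr (dotC y x); rewrite (dotC y x) in h; lra.
Qed.

Lemma dot0l (x : 'rV[R]_d) : dot 0 x = 0.
Proof. by rewrite /dot big1// => i _; rewrite mxE mul0r. Qed.

Lemma dot0r (x : 'rV[R]_d) : dot x 0 = 0.
Proof. by rewrite dotC dot0l. Qed.

Lemma ae_eq_Rintegral D u v : measurable D -> measurable_fun D u ->
  measurable_fun D v -> ae_eq mu D u v ->
  \int[mu]_(x in D) u x = \int[mu]_(x in D) v x.
Proof.
move=> mD mu_ mv uv; congr fine; apply: ae_eq_integral => //; try exact/measurable_EFinP.
by apply: filterS uv => x h Dx; rewrite h.
Qed.

Lemma ae_le_Rintegral D u v : measurable D -> mu.-integrable D (EFin \o u) ->
  mu.-integrable D (EFin \o v) -> {ae mu, forall x, D x -> u x <= v x} ->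
  \int[mu]_(x in D) u x <= \int[mu]_(x in D) v x.
Proof.
move=> mD iu iv uv; rewrite -subr_ge0 -RintegralB//.
have m1 : measurable_fun D (fun x => v x - u x).
  apply: measurable_funB; apply/measurable_EFinP.
    exact: measurable_int iv.
  exact: measurable_int iu.
rewrite (@ae_eq_Rintegral _ _ (fun x => Num.max (v x - u x) 0))//.
- by apply: Rintegral_ge0 => x _; rewrite le_max lexx orbT.
- exact: measurable_maxr.
- by apply: filterS uv => x h Dx; rewrite max_l// subr_ge0 h.
Qed.

Definition L2v D F := forall i, L2 D (fun x => F x ord0 i).

Lemma L2v_lin D (a : R) F G : measurable D -> L2v D F -> L2v D G ->
  L2v D (fun x => a *: F x + G x).
Proof.
move=> mD hF hG i; rewrite (_ : (fun x => _) = (fun x => a * F x ord0 i + G x ord0 i)).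
  by apply: L2D => //; exact: L2Z.
by apply/funext => x; rewrite !mxE.
Qed.

Lemma L2vB D F G : measurable D -> L2v D F -> L2v D G -> L2v D (fun x => F x - G x).
Proof.
move=> mD hF hG; rewrite (_ : (fun x => _) = (fun x => -1 *: G x + F x)).
  exact: L2v_lin.
by apply/funext => x; rewrite scaleN1r addrC.
Qed.

Lemma L2v_mul D u (K : R) F : measurable D -> measurable_fun D u ->
  (forall x, D x -> `|u x| <= K) -> L2v D F -> L2v D (fun x => u x *: F x).
Proof.
move=> mD mu_ uK hF i; rewrite (_ : (fun x => _) = (fun x => u x * F x ord0 i)).
  exact: (@L2_mul_bounded _ _ _ _ _ K).
by apply/funext => x; rewrite mxE.
Qed.

Lemma L2v_sum D (I : Type) (r : seq I) (F : I -> 'rV[R]_d -> 'rV[R]_d) :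
  measurable D -> (forall i, L2v D (F i)) -> L2v D (fun x => \sum_(i <- r) F i x).
Proof.
move=> mD hF j; rewrite (_ : (fun x => _) = (fun x => \sum_(i <- r) F i x ord0 j)).
  by apply: L2_sum => // i _; exact: hF.
by apply/funext => x; rewrite summxE.
Qed.

Lemma L2vS D E F : measurable D -> measurable E -> E `<=` D -> L2v D F -> L2v E F.
Proof. by move=> mD mE ED hF i; exact: L2S (hF i). Qed.

Lemma dot_integrable D F G : measurable D -> L2v D F -> L2v D G ->
  mu.-integrable D (EFin \o (fun x => dot (F x) (G x))).
Proof.
move=> mD hF hG.
rewrite (_ : _ \o _ = fun x => (\sum_(i < d) (F x ord0 i * G x ord0 i)%:E)%E).
  by apply: integrable_sum => // i _; exact: L2_mul_integrable.
by apply/funext => x /=; rewrite sumEFin.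
Qed.

Definition ip D F G : R := \int[mu]_(x in D) dot (F x) (G x).

Lemma ipC D F G : ip D F G = ip D G F.
Proof. by apply: eq_Rintegral => x _; rewrite dotC. Qed.

Lemma ip_linl D a F G H : measurable D -> L2v D F -> L2v D G -> L2v D H ->
  ip D (fun x => a *: F x + G x) H = a * ip D F H + ip D G H.
Proof.
move=> mD hF hG hH; rewrite /ip -RintegralZl//; last exact: dot_integrable.
have iF := integrableZl mD a (dot_integrable mD hF hH).
rewrite -RintegralD//; last exact: dot_integrable.
by apply: eq_Rintegral => x _; rewrite dotDl dotZl.
Qed.

Lemma ipBl D F G H : measurable D -> L2v D F -> L2v D G -> L2v D H ->
  ip D (fun x => F x - G x) H = ip D F H - ip D G H.
Proof.
move=> mD hF hG hH; rewrite /ip -RintegralB//; [|exact: dot_integrable..].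
by apply: eq_Rintegral => x _; rewrite dotBl.
Qed.

Lemma ipBr D F G H : measurable D -> L2v D F -> L2v D G -> L2v D H ->
  ip D H (fun x => F x - G x) = ip D H F - ip D H G.
Proof. by move=> *; rewrite ipC ipBl// !(ipC _ H). Qed.

Lemma ip_ge0 D F : 0 <= ip D F F.
Proof. by apply: Rintegral_ge0 => x _; exact: dot_ge0. Qed.

(** The algebra behind [jump_identity], for unspecified fields. *)
Lemma ip_exchange D F1 F2 F3 F4 F5 G : measurable D ->
  L2v D F1 -> L2v D F2 -> L2v D F3 -> L2v D F4 -> L2v D F5 -> L2v D G ->
  ip D F1 G = ip D F4 G -> ip D F3 G = ip D F5 G ->
  ip D (fun x => F1 x - F2 x) G =
  ip D (fun x => (F4 x - F5 x) - (F2 x - F3 x)) G.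
Proof.
move=> mD h1 h2 h3 h4 h5 hG e1 e3.
rewrite (ipBl mD h1 h2 hG) (ipBl mD (L2vB mD h4 h5) (L2vB mD h2 h3) hG).
by rewrite (ipBl mD h4 h5 hG) (ipBl mD h2 h3 hG) e1 e3; ring.
Qed.

Lemma l2norm_vec_ge0 D F : 0 <= l2norm_vec D F.
Proof. exact: sqrtr_ge0. Qed.

Lemma l2norm_vec_sqr D F : l2norm_vec D F ^+ 2 = ip D F F.
Proof. by rewrite /l2norm_vec sqr_sqrtr//; exact: ip_ge0. Qed.

Lemma ip_CS D F G : measurable D -> L2v D F -> L2v D G ->
  `|ip D F G| <= l2norm_vec D F * l2norm_vec D G.
Proof.
move=> mD hF hG.
have pos (t : R) : 0 <= ip D F F - 2 * t * ip D F G + t ^+ 2 * ip D G G.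
  have hFG := L2v_lin (- t) mD hG hF.
  have := ip_ge0 D (fun x => - t *: G x + F x).
  rewrite ip_linl// ![ip D _ (fun x => _ + _)]ipC !ip_linl// (ipC _ G F).
  by move=> h; rewrite (le_trans h)// le_eqVlt; apply/orP; left; apply/eqP; ring.
rewrite -(@ler_pXn2r _ 2)// ?nnegrE ?mulr_ge0 ?l2norm_vec_ge0//.
rewrite exprMn !l2norm_vec_sqr real_normK ?num_real//.
by apply: discriminant_le pos; exact: ip_ge0.
Qed.

Lemma dot_measurable D F G : measurable D -> L2v D F -> L2v D G ->
  measurable_fun D (fun x => dot (F x) (G x)).
Proof.
move=> mD hF hG; apply/measurable_EFinP.
exact: measurable_int (dot_integrable mD hF hG).
Qed.

Lemma eq_ae_ip D F F' G : measurable D -> L2v D F -> L2v D F' -> L2v D G ->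
  ae_eq mu D F F' -> ip D F G = ip D F' G.
Proof.
move=> mD hF hF' hG FF'; apply: ae_eq_Rintegral; rewrite //; try exact: dot_measurable.
by apply: filterS FF' => x h Dx; rewrite h.
Qed.

Lemma eq_ae_l2norm_vec D F F' : measurable D -> L2v D F -> L2v D F' ->
  ae_eq mu D F F' -> l2norm_vec D F = l2norm_vec D F'.
Proof.
move=> mD hF hF' FF'; congr Num.sqrt; rewrite -!/(ip D _ _).
by rewrite (eq_ae_ip _ hF hF')// ipC (eq_ae_ip _ hF hF')// ipC.
Qed.

(** Localization of an integral to the set off which one factor vanishes. *)
Lemma ipS D E F G : measurable D -> measurable E -> E `<=` D -> L2v D F -> L2v D G ->
  ae_eq mu (D `\` E) G (cst 0) -> ip D F G = ip E F G.
Proof.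
move=> mD mE ED hF hG G0.
rewrite /ip Rintegral_mkcond [RHS]Rintegral_mkcond.
have m1 := dot_measurable mD hF hG.
apply: ae_eq_Rintegral => //.
- by apply/(measurable_restrictT _ mD).
- by apply/(measurable_restrictT _ mE); exact: measurable_funS m1.
apply: filterS G0 => x h _; rewrite !patchE.
case: ifPn => xD; case: ifPn => xE //.
  rewrite h ?dot0r//; split; first exact: set_mem.
  by move=> /mem_set; exact/negP.
by exfalso; move/negP: xD; apply; apply/mem_set/ED/set_mem.
Qed.

Lemma le_l2norm_vecS D E F : measurable D -> measurable E -> E `<=` D -> L2v D F ->
  l2norm_vec E F <= l2norm_vec D F.
Proof.
move=> mD mE ED hF; rewrite ler_sqrt; last exact: ip_ge0.
rewrite [leLHS]Rintegral_mkcond [leRHS]Rintegral_mkcond.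
have mdF := dot_integrable mD hF hF.
have mdE := dot_integrable mE (L2vS mD mE ED hF) (L2vS mD mE ED hF).
apply: le_Rintegral => //.
- by have := (integrable_mkcond _ mE).1 mdE; rewrite restrict_EFin.
- by have := (integrable_mkcond _ mD).1 mdF; rewrite restrict_EFin.
move=> x _; rewrite !patchE; case: ifPn => xE; case: ifPn => xD //; rewrite ?dot_ge0//.
by exfalso; move/negP: xD; apply; apply/mem_set/ED/set_mem.
Qed.

(** The bound [K] is the essential one; the crude bound [K'] holds everywhere
    and only serves integrability. *)
Lemma le_l2norm_vec_mul D u (K K' : R) F : measurable D -> measurable_fun D u ->
  (forall x, D x -> `|u x| <= K') -> 0 <= K ->
  {ae mu, forall x, D x -> `|u x| <= K} -> L2v D F ->
  l2norm_vec D (fun x => u x *: F x) <= K * l2norm_vec D F.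
Proof.
move=> mD mu_ uK' K0 uK hF.
have huF := L2v_mul mD mu_ uK' hF.
rewrite -(@ler_pXn2r _ 2)// ?nnegrE ?mulr_ge0 ?l2norm_vec_ge0//.
rewrite exprMn !l2norm_vec_sqr /ip -RintegralZl//; last exact: dot_integrable.
apply: ae_le_Rintegral => //; first exact: dot_integrable.
  by have := integrableZl mD (K ^+ 2) (dot_integrable mD hF hF); congr (_.-integrable _ _).
apply: filterS uK => x h Dx; rewrite dotZl dotZr mulrA -expr2 ler_wpM2r ?dot_ge0//.
by rewrite -[u x ^+ 2]real_normK ?num_real// lerXn2r ?nnegrE// h.
Qed.

End inner_product.

(** * Weak gradients *)

Section weak_gradient.
Context {R : realType} {d : nat}.
Implicit Types (Om U A : set 'rV[R]_d) (u v w : 'rV[R]_d -> R).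
Implicit Types (g h : 'rV[R]_d -> 'rV[R]_d).
Local Notation mu := (leb d : {measure set 'rV[R]_d -> \bar R}).

Lemma is_wgrad_lin Om (a : R) u v g h : open Om -> L2 Om u -> L2 Om v ->
  is_wgrad Om u g -> is_wgrad Om v h ->
  is_wgrad Om (fun x => a * u x + v x) (fun x => a *: g x + h x).
Proof.
move=> oO hu hv [g2 gu] [h2 hv']; have mO := open_measurable_rV oO.
split; first exact: L2v_lin.
move=> phi i tphi.
have lin (s t p : 'rV[R]_d -> R) : L2 Om s -> L2 Om t -> L2 Om p ->
    \int[mu]_(x in Om) ((a * s x + t x) * p x) =
    a * \int[mu]_(x in Om) (s x * p x) + \int[mu]_(x in Om) (t x * p x).
  move=> hs ht hp; rewrite -RintegralZl//; last exact: L2_mul_integrable.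
  have isp := integrableZl mO a (L2_mul_integrable mO hs hp).
  rewrite -RintegralD//; last exact: L2_mul_integrable.
  by apply: eq_Rintegral => x _; ring.
under [in RHS]eq_Rintegral => x _ do rewrite !mxE.
rewrite !lin//; [|exact: L2_test tphi|exact: L2_partial_test tphi].
by rewrite gu// hv'//; ring.
Qed.

Lemma is_wgrad0 Om : measurable Om -> is_wgrad Om (cst 0) (cst 0).
Proof.
move=> mO; split.
  move=> i; rewrite (_ : (fun x => _) = cst 0); first exact: L2_0.
  by apply/funext => x; rewrite mxE.
move=> phi i _; rewrite (@eq_Rintegral _ _ _ mu Om (cst 0)); last by move=> x _; rewrite /= mul0r.
rewrite [in RHS](@eq_Rintegral _ _ _ mu Om (cst 0)); last by move=> x _; rewrite /= mxE mul0r.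
by rewrite Rintegral_cst// mul0r oppr0.
Qed.

Lemma is_wgrad_sum Om (I : Type) (r : seq I) (u : I -> 'rV[R]_d -> R)
    (g : I -> 'rV[R]_d -> 'rV[R]_d) : open Om ->
  (forall i, L2 Om (u i)) -> (forall i, is_wgrad Om (u i) (g i)) ->
  is_wgrad Om (fun x => \sum_(i <- r) u i x) (fun x => \sum_(i <- r) g i x).
Proof.
move=> oO hu hg; have mO := open_measurable_rV oO; elim: r => [|i r IH].
  rewrite (_ : (fun x => _) = cst 0); last by apply/funext => x; rewrite big_nil.
  rewrite [X in is_wgrad _ _ X](_ : _ = cst 0); last by apply/funext => x; rewrite big_nil.
  exact: is_wgrad0.
rewrite (_ : (fun x => _) = (fun x => 1 * u i x + \sum_(i <- r) u i x)); last first.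
  by apply/funext => x; rewrite big_cons mul1r.
rewrite [X in is_wgrad _ _ X](_ : _ = (fun x => 1 *: g i x + \sum_(i <- r) g i x)).
  by apply: is_wgrad_lin => //; exact: L2_sum.
by apply/funext => x; rewrite big_cons scale1r.
Qed.

(** Test functions on [U] are test functions on [Om], so the integrals over [U]
    of the components of [g] against them vanish, and the fundamental lemma
    applies on [U].  The case [U = Om] is the uniqueness of weak gradients. *)
Lemma is_wgrad_local Om U u g : open Om -> open U -> U `<=` Om ->
  L2 Om u -> is_wgrad Om u g -> ae_eq mu U u (cst 0) -> ae_eq mu U g (cst 0).
Proof.
move=> oO oU UO hu [g2 gu] u0.
have mO := open_measurable_rV oO; have mU := open_measurable_rV oU.
have g0 i : ae_eq mu U (fun x => g x ord0 i) (cst 0).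
  apply: fundamental_lemma => //; first exact: L2S (g2 i).
  move=> phi tphi.
  have tphiO : test_function Om phi.
    by case: tphi => h1 h2 h3; split => //; exact: subset_trans UO.
  have out x : ~ U x -> phi x = 0.
    move=> nU; apply: contrapT => /eqP hx; apply: nU; case: tphi => _ _; apply.
    exact: subset_closure.
  rewrite -(@Rintegral_support _ _ Om U)//; last by move=> x _ /out ->; rewrite mulr0.
  apply/eqP; rewrite -oppr_eq0 -gu//; apply/eqP.
  rewrite (@Rintegral_support _ _ Om U)//; last first.
    by move=> x _ nU; rewrite (@partial_test_out _ _ U)// ?mulr0.
  rewrite (@ae_eq_Rintegral _ _ _ _ (cst 0))//; first by rewrite Rintegral_cst// mul0r.
    apply: measurable_funM; first by have := L2S mO mU UO hu; case.
    by have := L2_partial_test i mU tphi; case.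
  by apply: filterS u0 => x h Ux; rewrite h//= mul0r.
have : \forall x \ae mu, forall i, U x -> g x ord0 i = 0 by apply: filter_forall.
by apply: filterS => x h Ux; apply/rowP => i; rewrite mxE h.
Qed.

Lemma is_wgrad_unique Om u g h : open Om -> L2 Om u ->
  is_wgrad Om u g -> is_wgrad Om u h -> ae_eq mu Om g h.
Proof.
move=> oO hu gu hu'; have mO := open_measurable_rV oO.
have := is_wgrad_local oO oO (@subset_refl _ Om) _ (is_wgrad_lin (-1) oO hu hu gu hu').
case.
- by apply: L2D => //; exact: L2Z.
- by apply: aeW => x _ /=; ring.
move=> N hN; exists N; case: hN => mN N0 sN; split => //.
apply: subset_trans sN => x /= hx; apply: contra_not hx => hx Ox.
by have /eqP := hx Ox; rewrite scaleN1r addrC subr_eq0 => /eqP.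
Qed.

Lemma wgradP Om u : H1 Om u -> is_wgrad Om u (wgrad Om u).
Proof. by move=> [_ [g hg]]; by apply: (@xgetPex _ _ (is_wgrad Om u)); exists g. Qed.

Lemma L2v_wgrad Om u : H1 Om u -> L2v Om (wgrad Om u).
Proof. by move=> /wgradP[]. Qed.

(** [wgrad] is a choice among the weak gradients; this identifies it. *)
Lemma wgrad_ae Om u g : open Om -> L2 Om u -> is_wgrad Om u g ->
  ae_eq mu Om (wgrad Om u) g.
Proof.
by move=> oO hu hg; apply: (is_wgrad_unique oO hu) => //; apply: wgradP; split => //; exists g.
Qed.

Lemma is_wgradB Om u v : open Om -> H1 Om u -> H1 Om v ->
  is_wgrad Om (u \- v) (fun x => wgrad Om u x - wgrad Om v x).
Proof.
move=> oO hu hv.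
have := is_wgrad_lin (-1) oO hv.1 hu.1 (wgradP hv) (wgradP hu).
rewrite (_ : (fun x => -1 * v x + u x) = u \- v); last by apply/funext => x /=; ring.
rewrite (_ : (fun x => -1 *: wgrad Om v x + wgrad Om u x) =
  (fun x => wgrad Om u x - wgrad Om v x))//.
by apply/funext => x; rewrite scaleN1r addrC.
Qed.

(** Off the essential support the function vanishes locally almost everywhere,
    hence almost everywhere. *)
Lemma wgrad_out_ess_supp Om A w : open Om -> closed A -> H1 Om w ->
  ess_supp Om w `<=` A -> ae_eq mu (Om `\` A) (wgrad Om w) (cst 0).
Proof.
move=> oO cA hw wA.
have oU : open (Om `\` A) by rewrite setDE; apply: openI => //; rewrite openC.
apply: (is_wgrad_local oO oU _ hw.1 (wgradP hw)); first by move=> x [].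
apply: negligible_local => x /not_implyP[[Ox nA] _].
have : ~ ess_supp Om w x by move=> /wA.
move=> /existsNP[V /not_implyP[oV /not_implyP[Vx /contrapT hV]]].
exists V; split => //; apply: negligibleS hV => y [Vy /not_implyP[[Oy _] wy]] /= h.
by apply: wy; apply: h.
Qed.

End weak_gradient.

(** * Null sets: Lipschitz images of facets *)

Section null_images.
Context {R : realType} {d : nat}.
Local Notation mu := (leb d : {measure set 'rV[R]_d -> \bar R}).
Local Notation cube := (cbox (const_mx 0) (const_mx 1) : set 'rV[R]_d).

Lemma cubeP (x : 'rV[R]_d) : cube x <-> forall i, 0 <= x ord0 i <= 1.
Proof. by split => h i; have := h i; rewrite !mxE. Qed.

Lemma measure_bigsetU_le (I : Type) (r : seq I) (F : I -> set 'rV[R]_d) :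
  (forall i, measurable (F i)) ->
  measurable (\big[setU/set0]_(i <- r) F i) /\
  (mu (\big[setU/set0]_(i <- r) F i) <= \sum_(i <- r) mu (F i))%E.
Proof.
move=> mF; elim: r => [|i r [mr hr]]; first by rewrite !big_nil measure0.
rewrite !big_cons; split; first exact: measurableU.
by apply: le_trans (leeD2l _ hr); exact: measureU2.
Qed.

Lemma negligible_small (A : set 'rV[R]_d) (C : R) :
  (forall n : nat, exists B, [/\ measurable B, A `<=` B &
    (mu B <= (C / n.+1%:R)%:E)%E]) -> mu.-negligible A.
Proof.
move=> /choice[B hB]; exists (\bigcap_n B n); split.
- by apply: bigcapT_measurable => n; have [] := hB n.
- apply/eqP; rewrite eq_le measure_ge0 andbT.
  have mcap : measurable (\bigcap_n B n) by apply: bigcapT_measurable => n; have [] := hB n.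
  have le n : (mu (\bigcap_n B n) <= (C * harmonic n)%:E)%E.
    have [mBn _ h] := hB n; apply: le_trans h.
    by apply: le_measure; rewrite ?inE//; exact: bigcap_inf.
  have cv : (fun n => (C * harmonic n)%:E) @ \oo --> 0%:E.
    apply: cvg_EFin; first exact: nearW.
    rewrite -[X in _ --> X](mulr0 C); apply: cvgM; [exact: cvg_cst|exact: cvg_harmonic].
  rewrite -[leRHS](cvg_lim _ cv)//; apply: lime_ge; first by apply/cvg_ex; exists 0%:E.
  exact: nearW.
- by move=> x Ax n _; have [_ h _] := hB n; exact: h.
Qed.

End null_images.

Section lipschitz_null.
Context {R : realType} {d : nat}.
Local Notation mu := (leb d.+1 : {measure set 'rV[R]_d.+1 -> \bar R}).
Local Notation cube := (cbox (const_mx 0) (const_mx 1) : set 'rV[R]_d.+1).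

Lemma grid_point n (t : R) : 0 <= t <= 1 ->
  exists k : 'I_n.+1, `|t - k%:R / n.+1%:R| <= n.+1%:R^-1.
Proof.
move=> /andP[t0 t1]; set N : R := n.+1%:R; have N0 : 0 < N by rewrite ltr0n.
have [k [k1 k2]] : exists k : nat, (k <= n)%N /\ k%:R <= t * N <= k%:R + 1.
  have [tn|tn] := lerP (t * N) n%:R; last first.
    exists n; split => //; rewrite (ltW tn)/= natr1 -/N.
    by rewrite ler_piMl// ltW.
  have tN0 : 0 <= t * N by rewrite mulr_ge0// ltW.
  exists (Num.trunc (t * N)); have /andP[h1 h2] := truncn_itv tN0.
  split; first by rewrite -(@ler_nat R); apply: le_trans tn.
  by rewrite h1 /= natr1 ltW.
exists (Ordinal (k1 : (k < n.+1)%N)) => /=.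
rewrite (_ : t - _ = (t * N - k%:R) / N); last by field; rewrite gt_eqF.
rewrite normrM [X in _ * X]ger0_norm ?invr_ge0 ?(ltW N0)// ler_piMl ?invr_ge0 ?(ltW N0)//.
by rewrite ler_norml; apply/andP; move: k2 => /andP[]; split; lra.
Qed.

(** The map depends on [d] of the [d + 1] variables, so a grid of [(n + 1) ^ d]
    points suffices to cover the image by cubes of side [2 L / (n + 1)], whose
    total volume is [(2 L) ^ (d + 1) / (n + 1)]. *)
Lemma negligible_lipschitz_image (f : 'rV[R]_d.+1 -> 'rV[R]_d.+1) (i0 : 'I_d.+1) (L : R) :
  (forall x y : 'rV[R]_d.+1, (forall j, j != i0 -> x ord0 j = y ord0 j) -> f x = f y) ->
  0 <= L ->
  (forall (x y : 'rV[R]_d.+1) (e : R), cube x -> cube y ->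
    (forall j, `|x ord0 j - y ord0 j| <= e) ->
    forall j, `|f x ord0 j - f y ord0 j| <= L * e) ->
  mu.-negligible (f @` cube).
Proof.
move=> fi L0 fL; apply: (@negligible_small _ _ _ ((2 * L) ^+ d.+1)) => n.
set N : R := n.+1%:R; have N0 : 0 < N by rewrite ltr0n.
pose p (a : {ffun 'I_d -> 'I_n.+1}) : 'rV[R]_d.+1 :=
  \row_j (if unlift i0 j is Some j' then (a j')%:R / N else 0).
pose B a := cbox (f (p a) - const_mx (L / N)) (f (p a) + const_mx (L / N)).
have vol a : mu (B a) = ((2 * L / N) ^+ d.+1)%:E.
  have ce i : (f (p a) - const_mx (L / N)) ord0 i <= (f (p a) + const_mx (L / N)) ord0 i.
    by rewrite !mxE (@le_trans _ _ (f (p a) ord0 i)) ?gerBl ?lerDl ?divr_ge0 ?(ltW N0).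
  rewrite [LHS](leb_cbox ce); congr EFin.
  rewrite (eq_bigr (fun=> 2 * L / N)); last by move=> i _; rewrite !mxE; ring.
  by rewrite prodr_const card_ord.
have pc a : cube (p a).
  apply/cubeP => i; rewrite mxE; case: unlift => [j|]; last by rewrite lexx ler01.
  rewrite divr_ge0 ?ler0n ?(ltW N0)//= ler_pdivrMr// mul1r ler_nat.
  exact: ltnW (ltn_ord _).
have [mU leU] := measure_bigsetU_le (index_enum _)
  (fun a => measurable_cbox _ _ : measurable (B a)).
exists (\big[setU/set0]_a B a); split => //.
- move=> _ [x cx <-].
  have cxi := (cubeP x).1 cx.
  have /choice[a ha] : forall j : 'I_d, exists k : 'I_n.+1,
      `|x ord0 (lift i0 j) - k%:R / N| <= N^-1.
    by move=> j; exact: grid_point.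
  rewrite -bigcup_seq; exists (finfun a); first by rewrite /= mem_index_enum.
  pose x' : 'rV[R]_d.+1 := \row_j (if j == i0 then 0 else x ord0 j).
  rewrite (fi x x'); last by move=> j ji; rewrite mxE (negbTE ji).
  have cx' : cube x'.
    by apply/cubeP => j; rewrite mxE; case: ifP => // _; rewrite lexx ler01.
  have close j : `|x' ord0 j - p (finfun a) ord0 j| <= N^-1.
    rewrite !mxE; case: (unliftP i0 j) => [j'|] ->.
      by rewrite eq_sym (negbTE (neq_lift _ _)) ffunE.
    by rewrite eqxx subr0 normr0 invr_ge0 ltW.
  move=> j; have := fL _ _ _ cx' (pc (finfun a)) close j.
  by rewrite !mxE ler_distl.
- apply: le_trans leU _.
  rewrite (eq_bigr (fun=> ((2 * L / N) ^+ d.+1)%:E)); last by move=> a _; exact: vol.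
  rewrite sumEFin lee_fin big_const_seq count_predT.
  have -> : size (index_enum {ffun 'I_d -> 'I_n.+1}) = (n.+1 ^ d)%N.
    by rewrite -[index_enum _]enumT -cardE card_ffun !card_ord.
  rewrite iter_addr addr0 -[X in X <= _]mulr_natr natrX -/N exprMn exprVn exprS.
  rewrite le_eqVlt; apply/orP; left; apply/eqP; rewrite exprS; field.
  by rewrite expf_neq0 ?gt_eqF.
Qed.

End lipschitz_null.

Section cells.
Context {R : realType}.

Lemma refcell_cube d k (x : 'rV[R]_d) : refcell k x -> forall i, 0 <= x ord0 i <= 1.
Proof.
case: k => [[x0 x1] i|//]; rewrite x0 /=; apply: le_trans x1.
by rewrite (bigD1 i)//= lerDl sumr_ge0.
Qed.

Lemma prod_lipschitz (I : Type) (r : seq I) (x y : I -> R) (e : R) : 0 <= e ->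
  (forall i, 0 <= x i <= 1) -> (forall i, 0 <= y i <= 1) ->
  (forall i, `|x i - y i| <= e) ->
  `|\prod_(i <- r) x i - \prod_(i <- r) y i| <= (size r)%:R * e.
Proof.
move=> e0 hx hy hxy; elim: r => [|i r IH]; first by rewrite !big_nil subrr normr0 mul0r.
rewrite !big_cons /=; set X := \prod_(_ <- r) x _; set Y := \prod_(_ <- r) y _.
rewrite (_ : _ - _ = (x i - y i) * X + y i * (X - Y)); last by ring.
rewrite -(natr1 (size r)) [leRHS]mulrDl (mul1r e) [leRHS]addrC.
rewrite (le_trans (ler_normD _ _))// !normrM lerD//.
  rewrite -[leRHS]mulr1 ler_pM// ger0_norm; first by apply: prodr_ile1.
  by apply: prodr_ge0 => j _; have /andP[] := hx j.
apply: le_trans IH; rewrite ler_piMl//; have /andP[h1 h2] := hy i.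
by rewrite ger0_norm.
Qed.

Lemma continuous_sumf d (I : Type) (r : seq I) (P : pred I) (u : I -> 'rV[R]_d -> R) :
  (forall i, continuous (u i)) -> continuous (fun x => \sum_(i <- r | P i) u i x).
Proof.
move=> cu; elim: r => [|i r IH].
  by rewrite (_ : (fun x => _) = cst 0); [exact: cst_continuous|apply/funext => x; rewrite big_nil].
case Pi : (P i).
  rewrite (_ : (fun x => _) = u i \+ (fun x => \sum_(j <- r | P j) u j x)).
    exact: continuous_addf.
  by apply/funext => x; rewrite big_cons Pi.
rewrite (_ : (fun x => _) = (fun x => \sum_(j <- r | P j) u j x))//.
by apply/funext => x; rewrite big_cons Pi.
Qed.

Lemma continuous_prodf d (I : Type) (r : seq I) (P : pred I) (u : I -> 'rV[R]_d -> R) :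
  (forall i, continuous (u i)) -> continuous (fun x => \prod_(i <- r | P i) u i x).
Proof.
move=> cu; elim: r => [|i r IH].
  by rewrite (_ : (fun x => _) = cst 1); [exact: cst_continuous|apply/funext => x; rewrite big_nil].
case Pi : (P i).
  rewrite (_ : (fun x => _) = u i \* (fun x => \prod_(j <- r | P j) u j x)).
    exact: continuous_mulf.
  by apply/funext => x; rewrite big_cons Pi.
rewrite (_ : (fun x => _) = (fun x => \prod_(j <- r | P j) u j x))//.
by apply/funext => x; rewrite big_cons Pi.
Qed.

Lemma shape_function_continuous d k (p : 'rV[R]_d -> R) :
  shape_function k p -> continuous p.
Proof.
have cc (i : 'I_d) : continuous (fun x : 'rV[R]_d => x ord0 i) by exact: coord_continuous.
case: k => [[c [a /funext ->]]|[c /funext ->]].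
  apply: (@continuous_addf _ _ (cst c)); first exact: cst_continuous.
  apply: continuous_sumf => i.
  by apply: (@continuous_mulf _ _ (cst _) (fun x => x ord0 i)); [exact: cst_continuous|exact: cc].
apply: continuous_sumf => S.
apply: (@continuous_mulf _ _ (cst _) (fun x => \prod_(i in S) x ord0 i)).
  exact: cst_continuous.
exact: (continuous_prodf (u := fun i x => x ord0 i)).
Qed.

Lemma shape_function_lipschitz d k (p : 'rV[R]_d -> R) : shape_function k p ->
  exists2 L : R, 0 <= L & forall (x y : 'rV[R]_d) (e : R), 0 <= e ->
    (k = Quad -> (forall i, 0 <= x ord0 i <= 1) /\ (forall i, 0 <= y ord0 i <= 1)) ->
    (forall j, `|x ord0 j - y ord0 j| <= e) -> `|p x - p y| <= L * e.
Proof.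
case: k => [[c [a pE]]|[c pE]].
  exists (\sum_i `|a ord0 i|) => [|x y e e0 _ xy]; first exact: sumr_ge0.
  rewrite !pE opprD addrACA subrr add0r /dot -sumrB mulr_suml.
  rewrite (le_trans (ler_norm_sum _ _ _))// ler_sum// => i _.
  by rewrite -mulrBr normrM ler_wpM2l.
exists (\sum_(S : {set 'I_d}) `|c S| * d%:R) => [|x y e e0 /(_ erefl)[cx cy] xy].
  by apply: sumr_ge0 => S _; rewrite mulr_ge0.
rewrite !pE -sumrB mulr_suml (le_trans (ler_norm_sum _ _ _))// ler_sum// => S _.
rewrite -mulrBr normrM -mulrA ler_wpM2l//.
rewrite -![\prod_(i in S) _]big_enum/=.
apply: le_trans (prod_lipschitz (enum S) e0 cx cy xy) _.
by rewrite ler_wpM2r// ler_nat -cardE -[leqRHS]card_ord max_card.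
Qed.

(** [A] is contained in the image of the cube under a Lipschitz map that
    ignores one variable.  For quadrilaterals the map must preserve the cube,
    because the shape functions are only Lipschitz there. *)
Definition flattened d k (A : set 'rV[R]_d.+1) :=
  exists i0 (g : 'rV[R]_d.+1 -> 'rV[R]_d.+1), [/\
    forall x y : 'rV[R]_d.+1,
      (forall j, j != i0 -> x ord0 j = y ord0 j) -> g x = g y,
    forall x : 'rV[R]_d.+1, A x -> (forall i, 0 <= x ord0 i <= 1) /\ g x = x,
    k = Quad -> forall x : 'rV[R]_d.+1,
      (forall i, 0 <= x ord0 i <= 1) -> forall i, 0 <= g x ord0 i <= 1 &
    forall (x y : 'rV[R]_d.+1) (e : R), 0 <= e ->
      (forall j, `|x ord0 j - y ord0 j| <= e) ->
      forall j, `|g x ord0 j - g y ord0 j| <= d.+1%:R * e].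

(** The map recovers one variable from the equation of the hyperplane that
    carries the facet. *)
Lemma facet_flattened d k (A : set 'rV[R]_d.+1) : facet k A -> flattened k A.
Proof.
have fixcoord (i : 'I_d.+1) (b : R) (B : set 'rV[R]_d.+1) : 0 <= b <= 1 ->
    B `<=` [set x : 'rV[R]_d.+1 | (forall i, 0 <= x ord0 i <= 1) /\ x ord0 i = b] ->
    flattened k B.
  move=> b01 hB; exists i, (fun x => \row_j (if j == i then b else x ord0 j)); split.
  - by move=> x y xy; apply/rowP => j; rewrite !mxE; case: ifPn => // /xy.
  - move=> x /hB[cx xb]; split => //; apply/rowP => j; rewrite mxE.
    by case: eqP => [->|].
  - by move=> _ x cx j; rewrite mxE; case: ifP.
  - move=> x y e e0 xy j; rewrite !mxE; case: ifP => _.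
      by rewrite subrr normr0 mulr_ge0.
    by apply: le_trans (xy j) _; rewrite ler_peMl// ler1n.
case: k fixcoord => fixcoord; last first.
  move=> [i [b ->]]; apply: (fixcoord i b%:R); first by case: b; rewrite /= ?lexx ler01.
  by move=> x [cx xb].
move=> [[i ->]|->].
  apply: (fixcoord i 0); first by rewrite lexx ler01.
  by move=> x [cx x0]; split => //; exact: refcell_cube cx.
exists ord0, (fun x => \row_j (if j == ord0
  then 1 - \sum_(l | l != ord0) x ord0 l else x ord0 j)); split.
- move=> x y xy; apply/rowP => j; rewrite !mxE; case: ifPn => // [_|/xy//].
  by congr (1 - _); apply: eq_bigr => l /xy.
- move=> x [cx /= sx]; split; first exact: refcell_cube cx.
  apply/rowP => j; rewrite mxE; case: eqP => [->|//].
  by rewrite -sx (bigD1 ord0)//= addrK.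
- by [].
- move=> x y e e0 xy j; rewrite !mxE; case: ifP => _; last first.
    by apply: le_trans (xy j) _; rewrite ler_peMl// ler1n.
  rewrite opprB addrCA addrA addrAC addrA subrK -sumrB.
  apply: (le_trans (ler_norm_sum _ _ _)).
  apply: (@le_trans _ _ (\sum_(l : 'I_d.+1) e)); last by rewrite sumr_const card_ord mulr_natl.
  rewrite [leRHS](bigID (fun l => l != ord0))/= -[leLHS]addr0 lerD ?sumr_ge0//.
  by apply: ler_sum => l _; rewrite distrC.
Qed.

End cells.

(** * Meshes: the elements are disjoint up to null sets *)

Section mesh.
Context {R : realType} {d : nat}.
Variables (Om : set 'rV[R]_d.+1) (M : cells R d.+1).
Hypotheses (oOm : open Om) (hM : is_mesh Om M).
Local Notation mu := (leb d.+1 : {measure set 'rV[R]_d.+1 -> \bar R}).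

Lemma compact_refcell k : compact (@refcell R d.+1 k).
Proof.
apply: (@subclosed_compact _ _ (cbox (const_mx 0) (const_mx 1))); last 2 first.
- exact: compact_cbox.
- by move=> x cx i; rewrite !mxE; exact: refcell_cube cx i.
case: k.
  have -> : @refcell R d.+1 Simplex = [set x : 'rV[R]_d.+1 | forall i, 0 <= x ord0 i] `&`
      [set x | (\sum_i x ord0 i) <= 1] by apply/seteqP; split => x.
  apply: closedI.
    rewrite (_ : [set x | _] = \bigcap_(i : 'I_d.+1) [set x : 'rV[R]_d.+1 | 0 <= x ord0 i]).
      by apply: closed_bigI => i _; apply: (@closed_coord _ _ i [set t | 0 <= t]); exact: closed_ge.
    by apply/seteqP; split => x h i; [move=> _|]; apply: h.
  apply: (@closed_comp _ _ (fun x : 'rV[R]_d.+1 => \sum_i x ord0 i) [set t | t <= 1]);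
    last exact: closed_le.
  by move=> x _; apply: continuous_sumf => i; exact: coord_continuous.
rewrite (_ : refcell Quad = cbox (const_mx 0) (const_mx 1)); first exact: closed_cbox.
by apply/seteqP; split => x h i; have := h i; rewrite !mxE.
Qed.

Lemma continuous_rV (f : 'rV[R]_d.+1 -> 'rV[R]_d.+1) :
  (forall i, continuous (fun x => f x ord0 i)) -> continuous f.
Proof.
move=> cf x A /nbhs_ballP[e /= e0 eA].
have : \forall y \near nbhs x, forall i, ball (f x ord0 i) e (f y ord0 i).
  by apply: filter_forall => i; apply: cf; exact: nbhsx_ballx.
by apply: filterS => y h; apply: eA; split => // i j; rewrite ord1.
Qed.

Lemma compact_body (T : elt M) : compact (body T).
Proof.
apply: continuous_compact; last exact: compact_refcell.
apply: continuous_subspaceT; apply: continuous_rV => i.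
by case: hM => h _ _ _ _; exact: shape_function_continuous (h T i).
Qed.

Lemma closed_body (T : elt M) : closed (body T).
Proof. by apply: compact_closed => //; exact: compact_body. Qed.

Lemma closed_region (S : {set elt M}) : closed (region S).
Proof.
by apply: closed_bigcup => [|T _]; [exact: finite_finset|exact: closed_body].
Qed.

Lemma measurable_bodyI (T : elt M) : measurable (body T `&` Om).
Proof.
apply: measurableI; last exact: open_measurable_rV.
by apply: closed_measurable_rV; exact: closed_body.
Qed.

Lemma measurable_regionI (S : {set elt M}) : measurable (region S `&` Om).
Proof.
apply: measurableI; last exact: open_measurable_rV.
by apply: closed_measurable_rV; exact: closed_region.
Qed.

Lemma bodies_cover x : Om x -> exists T : elt M, body T x.
Proof.
case: hM => _ _ _ h _ Ox; have : closure Om x by exact: subset_closure.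
by rewrite h => -[T _ Tx]; exists T.
Qed.

(** Distinct elements meet in the image of a proper face, hence inside that of
    a facet: the image of the cube under the element map composed with a map
    that flattens the facet. *)
Lemma negligible_overlap (T T' : elt M) : T != T' ->
  mu.-negligible (body T `&` body T').
Proof.
case: hM => sh _ _ _ h /h[A [_ [[F [[B FB] FK AE]] _ -> _]]].
have [i0 [g [gi gA gQ gL]]] := facet_flattened (FK _ FB).
have /choice[L hL] : forall i, exists L : R, 0 <= L /\ forall (x y : 'rV[R]_d.+1) (e : R), 0 <= e ->
    (kind T = Quad -> (forall i, 0 <= x ord0 i <= 1) /\ (forall i, 0 <= y ord0 i <= 1)) ->
    (forall j, `|x ord0 j - y ord0 j| <= e) -> `|emap T x ord0 i - emap T y ord0 i| <= L * e.
  by move=> i; have [L L0 hL] := shape_function_lipschitz (sh T i); exists L.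
suff : mu.-negligible ((emap T \o g) @` cbox (const_mx 0) (const_mx 1)).
  apply: negligibleS.
  move=> _ [x Ax <-]; have Bx : B x by move: Ax; rewrite AE; exact.
  by have [cx gx] := gA x Bx; exists x; [exact/cubeP|rewrite /= gx].
apply: (@negligible_lipschitz_image _ _ _ i0 ((\sum_i L i) * d.+1%:R)).
- by move=> x y xy /=; congr emap; exact: gi.
- by rewrite mulr_ge0// sumr_ge0// => i _; case: (hL i).
move=> x y e /cubeP cx /cubeP cy xy j.
have e0 : 0 <= e by apply: le_trans (xy j).
have [Lj0 hLj] := hL j.
have h1 := hLj (g x) (g y) (d.+1%:R * e) (mulr_ge0 (ler0n _ _) e0).
apply: le_trans (h1 _ (gL x y e e0 xy)) _.
  by move=> kQ; split; exact: gQ.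
rewrite mulrA ler_wpM2r// ler_wpM2r// (bigD1 j)//= lerDl sumr_ge0// => i _.
by case: (hL i).
Qed.

Definition overlaps : set 'rV[R]_d.+1 :=
  [set x | exists T T' : elt M, [/\ T != T', body T x & body T' x]].

Lemma negligible_overlaps : mu.-negligible overlaps.
Proof.
have : \forall x \ae mu, forall p : elt M * elt M, ~ (p.1 != p.2 /\ (body p.1 `&` body p.2) x).
  apply: filter_forall => -[T T'] /=.
  have [TT|TT] := eqVneq T T'; first by apply: aeW => x [].
  by apply: negligibleS (negligible_overlap TT) => x /= /contrapT[_].
by apply: negligibleS => x [T [T' [TT' Tx T'x]]] h; apply: (h (T, T')).
Qed.

(** Off the overlaps the indicator of a region is the sum of those of its
    elements. *)
Lemma Rintegral_region (S : {set elt M}) (f : 'rV[R]_d.+1 -> R) :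
  mu.-integrable Om (EFin \o f) ->
  \int[mu]_(x in region S `&` Om) f x = \sum_(T in S) \int[mu]_(x in body T `&` Om) f x.
Proof.
move=> intf; have mO := open_measurable_rV oOm.
have mf : measurable_fun Om f by apply/measurable_EFinP; exact: measurable_int intf.
have mr A : closed A -> measurable_fun Om (f \_ A).
  move=> cA; apply/measurable_restrict => //; first exact: closed_measurable_rV.
  by apply: measurable_funS mf => //.
have ir A : closed A -> mu.-integrable Om (EFin \o (f \_ A)).
  move=> cA; apply: le_integrable intf => //; first by apply/measurable_EFinP; exact: mr.
  by move=> x _ /=; rewrite patchE; case: ifP => // _; rewrite lee_fin normr0.
rewrite Rintegral_mkcondl.
under eq_bigr => T _ do rewrite Rintegral_mkcondl.
have sumE (r : seq (elt M)) :
    mu.-integrable Om (EFin \o (fun x => \sum_(T <- r) (f \_ (body T)) x)) /\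
    \int[mu]_(x in Om) (\sum_(T <- r) (f \_ (body T)) x) =
    \sum_(T <- r) \int[mu]_(x in Om) (f \_ (body T)) x.
  elim: r => [|T r [i1 IH]].
    rewrite big_nil (_ : (fun x => _) = cst 0); last by apply/funext => x; rewrite big_nil.
    by split; [exact: integrable0|rewrite Rintegral_cst// mul0r].
  rewrite (_ : (fun x => _) =
    (fun x => (f \_ (body T)) x + \sum_(T <- r) (f \_ (body T)) x)); last first.
    by apply/funext => x; rewrite big_cons.
  split; first exact: (integrableD mO (ir _ (@closed_body T)) i1).
  by rewrite RintegralD// ?big_cons ?IH//; exact: ir (@closed_body T).
rewrite -big_enum /= -(sumE _).2; apply: ae_eq_Rintegral => //.
- exact: mr (@closed_region S).
- by apply/measurable_EFinP; exact: measurable_int (sumE _).1.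
apply: negligibleS negligible_overlaps => x /not_implyP[Ox hx].
apply: contrapT => nov; apply: hx; rewrite big_enum/= patchE.
case: ifPn => [/set_mem[T /= TS Tx]|].
  rewrite (bigD1 T)//= patchE mem_set// big1 ?addr0// => T' /andP[_ TT'].
  rewrite patchE ifF//; apply/negbTE/negP => /set_mem T'x.
  by apply: nov; exists T', T.
move=> /negP xS; rewrite big1// => T TS; rewrite patchE ifF//.
by apply/negbTE/negP => /set_mem Tx; apply: xS; apply/mem_set; exists T.
Qed.

End mesh.

(** * The composed coefficient *)

Section coefficients.
Context {R : realType} {d : nat}.
Variables (Om : set 'rV[R]_d.+1) (alpha : 'rV[R]_d.+1 -> R -> R).
Variables (Lc lambda Lambda : R).
Hypotheses (oOm : open Om) (hLc : 0 < Lc).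
Hypothesis halpha : coefficient Om alpha Lc lambda Lambda.
Local Notation mu := (leb d.+1 : {measure set 'rV[R]_d.+1 -> \bar R}).

(** By Lipschitz continuity in the second variable the composition is the
    infimum of the functions [alpha x q + Lc |phi x - q|], [q] rational. *)
Lemma measurable_coefficient (phi : 'rV[R]_d.+1 -> R) : measurable_fun Om phi ->
  measurable_fun Om (fun x => alpha x (phi x)).
Proof.
move=> mphi; have mO := open_measurable_rV oOm; case: halpha => mal lip _ _.
apply: (measurability _ (RGenInftyO.measurableE R)) => // _ [_ [c ->] <-].
pose D q := fun x => alpha x (ratr q) + Lc * `|phi x - ratr q|.
have mD q : measurable_fun Om (D q).
  apply: measurable_funD; first by case: (mal (ratr q)).
  apply: measurable_funM => //; apply: measurableT_comp => //.
  exact: measurable_funB.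
rewrite (_ : _ `&` _ = \bigcup_q (Om `&` D q @^-1` `]-oo, c[)).
  by apply: bigcupT_measurable_rat => q; exact: mD.
apply/seteqP; split => [x [Ox]|x [q _ [Ox]]]; rewrite /= !in_itv /=.
  move=> ac; pose e := (c - alpha x (phi x)) / (2 * Lc).
  have e0 : 0 < e by rewrite divr_gt0 ?subr_gt0 ?mulr_gt0.
  have [|q] := @rat_in_itvoo R (phi x) (phi x + e); first by rewrite ltrDl.
  rewrite in_itv /= => /andP[q1 q2]; exists q => //; split => //=; rewrite in_itv /= /D.
  have h := lip x (ratr q) (phi x) Ox.
  rewrite (distrC (phi x)); set t := `|ratr q - phi x| in h *.
  have te : t < e by rewrite /t ger0_norm ?subr_ge0 ?ltW// ltrBlDr addrC.
  have {}h := le_trans (ler_norm _) h.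
  have : 2 * Lc * t < c - alpha x (phi x) by rewrite -ltr_pdivlMl ?mulr_gt0// mulrC.
  by lra.
move=> h; split => //; apply: le_lt_trans h.
by have := le_trans (ler_norm _) (lip x (phi x) (ratr q) Ox); rewrite /D; lra.
Qed.

Lemma coefficient_bound x s : Om x -> `|alpha x s| <= Lambda.
Proof.
move=> Ox; case: halpha => _ _ _ /(_ x s (delta_mx ord0 ord0) Ox).
have -> : enorm (alpha x s *: delta_mx ord0 ord0 : 'rV[R]_d.+1) =
    `|alpha x s| * enorm (delta_mx ord0 ord0 : 'rV[R]_d.+1).
  by rewrite /enorm dotZl dotZr mulrA -expr2 sqrtrM ?sqr_ge0// sqrtr_sqr.
rewrite ler_pM2r// sqrtr_gt0 /dot (bigD1 ord0)//= !mxE eqxx mulr1 ltr_pwDl//.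
by apply: sumr_ge0 => i _; rewrite -expr2 sqr_ge0.
Qed.

Lemma coefficient_coercive x s (v : 'rV[R]_d.+1) : Om x ->
  lambda * dot v v <= dot (alpha x s *: v) v.
Proof.
move=> Ox; case: halpha => _ _ /(_ x s v Ox) + _.
by rewrite /enorm sqr_sqrtr ?dot_ge0.
Qed.

Lemma linf_norm_ge0 D u : 0 <= linf_norm Om D u.
Proof. by apply: fine_ge0; exact: Lnorm_ge0. Qed.

(** The bound on [u] makes the essential supremum finite, so that taking its
    real part loses nothing. *)
Lemma linf_norm_ae D u (K : R) : (forall x, Om x -> `|u x| <= K) ->
  {ae mu, forall x, (D `&` Om) x -> `|u x| <= linf_norm Om D u}.
Proof.
move=> uK; rewrite /linf_norm unlock; case: ifPn => [muT|]; last first.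
  by rewrite -leNgt measure_le0 => /eqP h; exact: measure0_ae.
set f := abse \o _.
have fK : (ess_sup mu f <= `|K|%:E)%E.
  apply/ess_supP; apply: aeW => x; rewrite /f /= lee_fin patchE.
  case: ifPn => [/set_mem[_ Ox]|_]; last by rewrite normr0.
  by rewrite (le_trans (uK _ Ox))// ler_norm.
have f0 : (0 <= ess_sup mu f)%E by apply: ess_sup_gee => //; apply: aeW => x; exact: abse_ge0.
have ff : ess_sup mu f \is a fin_num by rewrite ge0_fin_numE// (le_lt_trans fK)// ltry.
have := ess_sup_ge mu f; apply: filterS => x + Dx.
by rewrite -lee_fin fineK// /f /= patchE mem_set.
Qed.

End coefficients.

(** * Patches of elements *)

Section layers.
Context {R : realType} {d : nat} (M : cells R d).
Implicit Types (T : elt M) (S : {set elt M}).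

Lemma body_neq0 T : body T !=set0.
Proof.
exists (emap T 0); exists 0 => //; case: (kind T) => /=.
  by split => [i|]; rewrite ?mxE// big1 ?ler01// => i _; rewrite mxE.
by move=> i; rewrite mxE lexx ler01.
Qed.

Lemma in_neighbours S T' : (T' \in neighbours S) <->
  exists2 T, T \in S & body T' `&` body T !=set0.
Proof. by rewrite inE; split => [/asboolP|h]; [|apply/asboolP]. Qed.

Lemma mem_layers k T : T \in layers k T.
Proof.
elim: k => [|k IH]; first by rewrite inE.
apply/in_neighbours; exists T => //.
by have [x Tx] := body_neq0 T; exists x.
Qed.

Lemma iter_neighboursS k S S' : S \subset S' ->
  iter k (@neighbours _ _ M) S \subset iter k (@neighbours _ _ M) S'.
Proof.
move=> SS'; elim: k => //= k /fintype.subsetP IH; apply/fintype.subsetP => T.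
by move=> /in_neighbours[T' /IH hT' TT']; apply/in_neighbours; exists T'.
Qed.

(** Reversing a chain of neighbours.  It turns the number of patches that
    contain an element into the size of the patch of that element. *)
Lemma layers_sym k T T' : T' \in layers k T -> T \in layers k T'.
Proof.
elim: k T' => [|k IH] T'; first by rewrite !inE eq_sym.
move=> /in_neighbours[T'' /IH hT'' [x [T'x T''x]]].
rewrite /layers iterSr; apply: (fintype.subsetP (iter_neighboursS k _)) hT''.
rewrite finset.sub1set; apply/in_neighbours; exists T'; first by rewrite inE.
by exists x.
Qed.

End layers.

(** * Stability of the correctors *)

Section corrector_stability.
Context {R : realType} {d : nat}.
Variables (Om : set 'rV[R]_d.+1) (alpha : 'rV[R]_d.+1 -> R -> R).
Variables (Lc lambda Lambda : R).
Hypotheses (oOm : open Om) (hLc : 0 < Lc) (hlambda : 0 < lambda) (hLambda : 0 < Lambda).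
Hypothesis halpha : coefficient Om alpha Lc lambda Lambda.
Variable M : cells R d.+1.
Hypothesis hM : is_mesh Om M.
Variable I : ('rV[R]_d.+1 -> R) -> 'rV[R]_d.+1 -> R.
Variable k : nat.
Local Notation mu := (leb d.+1 : {measure set 'rV[R]_d.+1 -> \bar R}).
Local Notation field := ('rV[R]_d.+1 -> 'rV[R]_d.+1).
Local Notation operator := (elt M -> ('rV[R]_d.+1 -> R) -> 'rV[R]_d.+1 -> R).
Implicit Types (T : elt M) (v w phi : 'rV[R]_d.+1 -> R) (F G : field).

Let mO : measurable Om := open_measurable_rV oOm.
Let B T := body T `&` Om.
Let N T := region (layers k T) `&` Om.
Let mB T : measurable (B T) := measurable_bodyI oOm hM T.
Let mN T : measurable (N T) := measurable_regionI oOm hM (layers k T).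
Let BO T : B T `<=` Om. Proof. exact: subIsetr. Qed.
Let NO T : N T `<=` Om. Proof. exact: subIsetr. Qed.

Lemma L2v_indic D T F : measurable D -> L2v D F ->
  L2v D (fun x => \1_(body T) x *: F x).
Proof.
move=> mD hF; apply: (@L2v_mul _ _ _ _ 1) => //.
  by apply: measurable_indic; apply: closed_measurable_rV; exact: (closed_body hM).
by move=> x _; rewrite indicE; case: (_ \in _); rewrite ?normr1 ?normr0.
Qed.

Lemma ip_indic D T F G : body T `&` D = B T ->
  ip D (fun x => \1_(body T) x *: F x) G = ip (B T) F G.
Proof.
move=> <-; rewrite /ip Rintegral_mkcondl; apply: eq_Rintegral => x _.
by rewrite dotZl patchE indicE; case: (_ \in _); rewrite ?mul1r ?mul0r.
Qed.

Lemma cancel_norm (a n m : R) : 0 < n -> lambda * n ^+ 2 <= a * m * n ->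
  n <= a / lambda * m.
Proof.
move=> n0; rewrite expr2 mulrA ler_pM2r// => h.
by rewrite mulrAC ler_pdivlMr// mulrC.
Qed.

Lemma VH_H1 v : VH Om M v -> H1 Om v. Proof. by case=> -[]. Qed.

Lemma scale_defect (a p c : R) (y z : 'rV[R]_d.+1) :
  (a - p) *: (c *: y - z) = (c *: (a *: y) - c *: (p *: y)) - (a *: z - p *: z).
Proof. by rewrite scalerBr !scalerA -!scalerBl -mulrBr mulrC. Qed.

(** The field in the numerator of [quotients]. *)
Definition defect (Q : operator) T w : field :=
  fun x => \1_(body T) x *: wgrad Om w x - wgrad Om (Q T w) x.

Section one_coefficient.
Variables (phi : 'rV[R]_d.+1 -> R) (hphi : H10 Om phi).
Variables (Q : operator) (hQ : is_corrector Om alpha I k phi Q).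

Let a x := alpha x (phi x).

Lemma measurable_alpha : measurable_fun Om a.
Proof. by apply: (measurable_coefficient oOm hLc halpha); case: hphi.1.1. Qed.

Lemma L2v_alpha D F : measurable D -> D `<=` Om -> L2v D F -> L2v D (fun x => a x *: F x).
Proof.
move=> mD DO hF; apply: (@L2v_mul _ _ _ _ Lambda) => //.
  exact: measurable_funS measurable_alpha.
by move=> x /DO Ox; exact: coefficient_bound halpha _ _ Ox.
Qed.

Lemma ip_coercive D F : measurable D -> D `<=` Om -> L2v D F ->
  lambda * ip D F F <= ip D (fun x => a x *: F x) F.
Proof.
move=> mD DO hF; rewrite /ip -RintegralZl//; last exact: dot_integrable.
apply: le_Rintegral => //.
- by have := integrableZl mD lambda (dot_integrable mD hF hF); congr (_.-integrable _ _).
- by apply: dot_integrable => //; exact: L2v_alpha.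
- by move=> x /DO Ox; exact: (coefficient_coercive halpha).
Qed.

Lemma corrector_H1 T v : VH Om M v -> H1 Om (Q T v).
Proof. by move=> hv; case: (hQ T hv) => -[[[? _] _] _] _. Qed.

(** The patch is compact, so taking its closure adds no points. *)
Lemma corrector_out T v : VH Om M v ->
  ae_eq mu (Om `\` N T) (wgrad Om (Q T v)) (cst 0).
Proof.
move=> hv; have [[_ sub] _] := hQ T hv.
have cl : closed (region (layers k T)) := @closed_region R d Om M hM (layers k T).
rewrite -(closure_id _).1 // in sub.
have := wgrad_out_ess_supp oOm cl (corrector_H1 T hv) sub.
by apply: ae_eq_subset => x [Ox nN]; split => // rx; apply: nN.
Qed.

Lemma corrector_eq T v w : VH Om M v -> Wpatch Om I k T w ->
  ip (N T) (fun x => a x *: wgrad Om (Q T v) x) (wgrad Om w) =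
  ip (B T) (fun x => a x *: wgrad Om v x) (wgrad Om w).
Proof. by move=> hv hw; case: (hQ T hv) => _ /(_ w hw). Qed.

(** Testing the equation of the corrector with the corrector itself; this is
    what keeps [quotients] bounded. *)
Lemma corrector_energy T v : VH Om M v ->
  l2norm_vec Om (wgrad Om (Q T v)) <=
  Lambda / lambda * l2norm_vec (B T) (wgrad Om v).
Proof.
move=> hv; set g := wgrad Om (Q T v).
have hg : L2v Om g := L2v_wgrad (corrector_H1 T hv).
have hgv : L2v Om (wgrad Om v) := L2v_wgrad (VH_H1 hv).
have hgB : L2v (B T) g := L2vS mO (mB T) (@BO T) hg.
have hgN : L2v (N T) g := L2vS mO (mN T) (@NO T) hg.
have hgvB : L2v (B T) (wgrad Om v) := L2vS mO (mB T) (@BO T) hgv.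
have [->|n0] := eqVneq (l2norm_vec Om g) 0.
  by rewrite mulr_ge0 ?l2norm_vec_ge0// divr_ge0 ?ltW.
have npos : 0 < l2norm_vec Om g by rewrite lt_def n0 l2norm_vec_ge0.
apply: (cancel_norm npos); rewrite l2norm_vec_sqr.
rewrite (ipS mO (mN T) (@NO T) hg hg (corrector_out T hv)).
apply: (le_trans (ip_coercive (mN T) (@NO T) hgN)).
rewrite (corrector_eq hv (hQ T hv).1).
apply: (le_trans (ler_norm _)).
apply: (le_trans (ip_CS (mB T) (L2v_alpha (mB T) (@BO T) hgvB) hgB)).
apply: ler_pM; rewrite ?l2norm_vec_ge0//; last exact: le_l2norm_vecS.
have aL x : (B T) x -> `|a x| <= Lambda by move=> [_ Ox]; exact: coefficient_bound halpha _ _ Ox.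
apply: (le_l2norm_vec_mul (mB T) _ aL (ltW hLambda)) => //.
  exact: measurable_funS measurable_alpha.
exact: aeW.
Qed.

Lemma L2v_defect T w : VH Om M w -> L2v Om (defect Q T w).
Proof.
move=> hw; apply: L2vB => //; last exact: L2v_wgrad (corrector_H1 T hw).
exact: L2v_indic (L2v_wgrad (VH_H1 hw)).
Qed.

Lemma defect_bound T T' w : VH Om M w ->
  l2norm_vec (B T') (defect Q T w) ^+ 2 <=
  2 * (1 + (Lambda / lambda) ^+ 2) * l2norm_vec (B T) (wgrad Om w) ^+ 2.
Proof.
move=> hw; have hD := L2v_defect T hw.
have hgw : L2v Om (wgrad Om w) := L2v_wgrad (VH_H1 hw).
have hg : L2v Om (wgrad Om (Q T w)) := L2v_wgrad (corrector_H1 T hw).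
have hX := L2v_indic T mO hgw.
apply: (@le_trans _ _ (l2norm_vec Om (defect Q T w) ^+ 2)).
  by rewrite lerXn2r ?nnegrE ?l2norm_vec_ge0// le_l2norm_vecS.
have E : ip Om (fun x => \1_(body T) x *: wgrad Om w x)
    (fun x => \1_(body T) x *: wgrad Om w x)
    = l2norm_vec (B T) (wgrad Om w) ^+ 2.
  rewrite ip_indic// ipC l2norm_vec_sqr; apply: eq_Rintegral => x /set_mem[Tx _].
  by rewrite dotZl indicE mem_set// mul1r.
have En := corrector_energy T hw.
have {}En : ip Om (wgrad Om (Q T w)) (wgrad Om (Q T w)) <=
    (Lambda / lambda) ^+ 2 * l2norm_vec (B T) (wgrad Om w) ^+ 2.
  have LL0 : 0 <= Lambda / lambda by rewrite divr_ge0// ltW.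
  rewrite -l2norm_vec_sqr -exprMn lerXn2r ?nnegrE ?l2norm_vec_ge0//.
  by rewrite mulr_ge0// l2norm_vec_ge0.
apply: (@le_trans _ _ (2 * ip Om (fun x => \1_(body T) x *: wgrad Om w x)
    (fun x => \1_(body T) x *: wgrad Om w x)
  + 2 * ip Om (wgrad Om (Q T w)) (wgrad Om (Q T w)))); last by rewrite E; lra.
rewrite l2norm_vec_sqr /ip -!RintegralZl//; try exact: dot_integrable.
have i1 := integrableZl mO 2 (dot_integrable mO hX hX).
have i2 := integrableZl mO 2 (dot_integrable mO hg hg).
rewrite -RintegralD//.
apply: le_Rintegral => //; first exact: dot_integrable.
  by have := integrableD mO i1 i2; congr (_.-integrable _ _).
by move=> x _; exact: dotB_le2.
Qed.

Lemma quotients_ubound T T' :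
  ubound (quotients Om Q T T') (2 * (1 + (Lambda / lambda) ^+ 2)).
Proof.
move=> _ [w [hw _ ->]]; rewrite /semi1.
set s := l2norm_vec (B T) (wgrad Om w).
have [->|s0] := eqVneq s 0.
  by rewrite expr0n /= invr0 mulr0 mulr_ge0// addr_ge0// sqr_ge0.
rewrite ler_pdivrMr; last by rewrite exprn_gt0// lt_def s0 l2norm_vec_ge0.
exact: defect_bound.
Qed.

Lemma sup_quotients_ge0 T T' : 0 <= sup (quotients Om Q T T').
Proof.
have [->|/set0P[r hr]] := eqVneq (quotients Om Q T T') set0; first by rewrite sup0.
apply: (@le_trans _ _ r); last first.
  apply: ub_le_sup => //; exists (2 * (1 + (Lambda / lambda) ^+ 2)).
  exact: quotients_ubound.
by case: hr => w [_ _ ->]; rewrite divr_ge0 ?sqr_ge0.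
Qed.

(** The supremum is only meaningful because the quotients are bounded.  When
    the denominator vanishes there is no quotient, but then [defect_bound]
    makes the defect vanish. *)
Lemma defect_le_sup T T' v : VH Om M v ->
  l2norm_vec (B T') (defect Q T v) ^+ 2 <=
  sup (quotients Om Q T T') * semi1 Om (body T) v ^+ 2.
Proof.
move=> hv; rewrite /semi1; have := defect_bound T T' hv.
set s := l2norm_vec (B T) (wgrad Om v); have [->|s0 _] := eqVneq s 0.
  by rewrite expr0n /= !mulr0.
have spos : 0 < s ^+ 2 by rewrite exprn_gt0// lt_def s0 l2norm_vec_ge0.
rewrite -ler_pdivrMr//; apply: ub_le_sup.
  by exists (2 * (1 + (Lambda / lambda) ^+ 2)); exact: quotients_ubound.
exists v; split => // ae0; move: s0; rewrite /s.
have hg : L2v (B T) (wgrad Om v) := L2vS mO (mB T) (@BO T) (L2v_wgrad (VH_H1 hv)).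
have z0 : L2v (B T) (cst 0).
  by move=> i; rewrite (_ : (fun x => _) = cst 0); [exact: L2_0|apply/funext => x; rewrite mxE].
rewrite (eq_ae_l2norm_vec (mB T) hg z0 ae0) => /eqP; apply.
apply/eqP; rewrite -sqrf_eq0 l2norm_vec_sqr /ip; apply/eqP.
rewrite (@eq_Rintegral _ _ _ mu _ (cst 0)); last by move=> x _; rewrite dot0l.
by rewrite Rintegral_cst// mul0r.
Qed.

End one_coefficient.

Variables psi xi : 'rV[R]_d.+1 -> R.
Hypotheses (hpsi : H10 Om psi) (hxi : H10 Om xi).
Variables Qpsi Qxi : operator.
Hypotheses (hQpsi : is_corrector Om alpha I k psi Qpsi)
  (hQxi : is_corrector Om alpha I k xi Qxi).

Let jump T v : field := fun x => wgrad Om (Qxi T v) x - wgrad Om (Qpsi T v) x.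
Let e_ := eT Om alpha k Qpsi xi psi.

Lemma L2v_jump T v : VH Om M v -> L2v Om (jump T v).
Proof.
move=> hv.
exact: (L2vB mO (L2v_wgrad (corrector_H1 hQxi T hv)) (L2v_wgrad (corrector_H1 hQpsi T hv))).
Qed.

Lemma jump_out T v : VH Om M v -> ae_eq mu (Om `\` N T) (jump T v) (cst 0).
Proof.
move=> hv; apply: filterS2 (corrector_out hQxi T hv) (corrector_out hQpsi T hv).
by move=> x h1 h2 Dx; rewrite /jump (h1 Dx) (h2 Dx) subr0.
Qed.

Let diff x := alpha x (xi x) - alpha x (psi x).

Lemma diff_bound x : Om x -> `|diff x| <= Lambda + Lambda.
Proof.
by move=> Ox; rewrite (le_trans (ler_normB _ _))// lerD ?(coefficient_bound halpha).
Qed.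

Lemma measurable_diff : measurable_fun Om diff.
Proof. by apply: measurable_funB; exact: measurable_alpha. Qed.

(** Each equation may be tested with either corrector, hence with their
    difference.  The equation for [xi] replaces [grad Qxi v] by [grad v] on [T];
    subtracting the equation for [psi] then leaves only differences of the two
    coefficients. *)
Lemma jump_identity T v : VH Om M v ->
  ip (N T) (fun x => alpha x (xi x) *: jump T v x) (jump T v) =
  ip (N T) (fun x => diff x *: defect Qpsi T v x) (jump T v).
Proof.
move=> hv.
pose ax x := alpha x (xi x); pose ap x := alpha x (psi x).
pose gx := wgrad Om (Qxi T v); pose gp := wgrad Om (Qpsi T v); pose gv := wgrad Om v.
have hgx : L2v Om gx := L2v_wgrad (corrector_H1 hQxi T hv).
have hgp : L2v Om gp := L2v_wgrad (corrector_H1 hQpsi T hv).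
have hgv : L2v Om gv := L2v_wgrad (VH_H1 hv).
have toN F : L2v Om F -> L2v (N T) F by apply: L2vS.
have toB F : L2v Om F -> L2v (B T) F by apply: L2vS.
have hax F : L2v Om F -> L2v Om (fun x => ax x *: F x) by move=> hF; exact: L2v_alpha hxi _ _ _ _ _.
have hap F : L2v Om F -> L2v Om (fun x => ap x *: F x) by move=> hF; exact: L2v_alpha hpsi _ _ _ _ _.
have hJ := L2v_jump T hv.
have Wx : Wpatch Om I k T (Qxi T v) by case: (hQxi T hv).
have Wp : Wpatch Om I k T (Qpsi T v) by case: (hQpsi T hv).
have ex : ip (N T) (fun x => ax x *: gx x) (jump T v) = ip (B T) (fun x => ax x *: gv x) (jump T v).
  rewrite -[jump T v]/(fun x => gx x - gp x).
  rewrite (ipBr (mN T) (toN _ hgx) (toN _ hgp) (toN _ (hax _ hgx))).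
  rewrite (ipBr (mB T) (toB _ hgx) (toB _ hgp) (toB _ (hax _ hgv))).
  by rewrite !(corrector_eq hQxi).
have ep : ip (N T) (fun x => ap x *: gp x) (jump T v) = ip (B T) (fun x => ap x *: gv x) (jump T v).
  rewrite -[jump T v]/(fun x => gx x - gp x).
  rewrite (ipBr (mN T) (toN _ hgx) (toN _ hgp) (toN _ (hap _ hgp))).
  rewrite (ipBr (mB T) (toB _ hgx) (toB _ hgp) (toB _ (hap _ hgv))).
  by rewrite !(corrector_eq hQpsi).
have BNT : body T `&` N T = B T.
  have sub : body T `<=` region (layers k T).
    by move=> x Tx; exists T; [exact: mem_layers|exact: Tx].
  by rewrite /N setIA (setIidl sub).
have -> : (fun x => alpha x (xi x) *: jump T v x) = (fun x => ax x *: gx x - ax x *: gp x).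
  by apply/funext => x; rewrite /jump scalerBr.
have -> : (fun x => diff x *: defect Qpsi T v x) =
    (fun x => (\1_(body T) x *: (ax x *: gv x) - \1_(body T) x *: (ap x *: gv x))
      - (ax x *: gp x - ap x *: gp x)).
  by apply/funext => x; exact: scale_defect.
have i1 := toN _ (hax _ hgx); have i2 := toN _ (hax _ hgp); have i3 := toN _ (hap _ hgp).
have i4 := L2v_indic T (mN T) (toN _ (hax _ hgv)).
have i5 := L2v_indic T (mN T) (toN _ (hap _ hgv)).
have iJ := toN _ hJ.
exact: (ip_exchange (mN T) i1 i2 i3 i4 i5 iJ (etrans ex (esym (ip_indic _ _ BNT)))
  (etrans ep (esym (ip_indic _ _ BNT)))).
Qed.

(** Coercivity bounds the left side of [jump_identity] from below.  On the
    right, each element of the patch contributes at most the essential supremum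
    of the coefficient difference times two norms, and Cauchy--Schwarz for the
    sum over the patch assembles [eT]. *)
Lemma jump_estimate T v : VH Om M v ->
  l2norm_vec Om (jump T v) <= lambda^-1 * e_ T * semi1 Om (body T) v.
Proof.
move=> hv; set J := jump T v; have hJ : L2v Om J := L2v_jump T hv.
have JN : L2v (N T) J := L2vS mO (mN T) (@NO T) hJ.
pose F := defect Qpsi T v.
have hF : L2v Om F := L2v_defect hQpsi T hv.
have hdF : L2v Om (fun x => diff x *: F x).
  exact: L2v_mul measurable_diff diff_bound hF.
set s := semi1 Om (body T) v; have s0 : 0 <= s by exact: sqrtr_ge0.
pose li T' := linf_norm Om (body T') diff.
pose q T' := sup (quotients Om Qpsi T T').
have eE : e_ T = Num.sqrt (\sum_(T' in layers k T) li T' ^+ 2 * q T') by [].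
have e0 : 0 <= e_ T by rewrite eE sqrtr_ge0.
have q0 T' : 0 <= q T' := sup_quotients_ge0 hpsi hQpsi T T'.
have ipN f g : L2v Om f -> L2v Om g -> ip (N T) f g = \sum_(T' in layers k T) ip (B T') f g.
  by move=> hf hg; rewrite /ip (Rintegral_region oOm hM)//; exact: dot_integrable.
have key : lambda * l2norm_vec Om J ^+ 2 <= e_ T * s * l2norm_vec Om J.
  rewrite l2norm_vec_sqr (ipS mO (mN T) (@NO T) hJ hJ (jump_out T hv)).
  apply: (le_trans (ip_coercive hxi (mN T) (@NO T) JN)).
  rewrite jump_identity// ipN//.
  apply: (@le_trans _ _ (\sum_(T' in layers k T)
      (li T' * Num.sqrt (q T') * s) * l2norm_vec (B T') J)).
    apply: ler_sum => T' _; apply: (le_trans (ler_norm _)).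
    have hB f : L2v Om f -> L2v (B T') f by apply: L2vS.
    apply: (le_trans (ip_CS (mB T') (hB _ hdF) (hB _ hJ))).
    rewrite ler_wpM2r ?l2norm_vec_ge0//.
    have dB x : (B T') x -> `|diff x| <= Lambda + Lambda by move=> [_]; exact: diff_bound.
    apply: (le_trans (le_l2norm_vec_mul (mB T') (measurable_funS mO (@BO T') measurable_diff) dB
      (linf_norm_ge0 Om (body T') diff) (linf_norm_ae (body T') diff_bound) (hB _ hF))).
    rewrite -mulrA ler_wpM2l ?linf_norm_ge0//.
    rewrite -(@ler_pXn2r _ 2)// ?nnegrE ?l2norm_vec_ge0 ?mulr_ge0 ?sqrtr_ge0//.
    rewrite exprMn (sqr_sqrtr (q0 T')).
    exact: (defect_le_sup hpsi hQpsi T T' hv).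
  rewrite -(@ler_pXn2r _ 2)// ?nnegrE; last 2 first.
  - by apply: sumr_ge0 => T' _; rewrite !mulr_ge0 ?l2norm_vec_ge0 ?linf_norm_ge0 ?sqrtr_ge0.
  - by rewrite !mulr_ge0 ?l2norm_vec_ge0.
  apply: (le_trans (sum_CS _ _ _ _)); rewrite [leRHS]exprMn.
  apply: ler_pM; rewrite ?sumr_ge0//; try by move=> ? _; rewrite sqr_ge0.
    rewrite exprMn eE sqr_sqrtr; last by apply: sumr_ge0 => T' _; rewrite mulr_ge0 ?sqr_ge0.
    rewrite mulr_suml le_eqVlt; apply/orP; left; apply/eqP; apply: eq_bigr => T' _.
    by rewrite !exprMn sqr_sqrtr.
  rewrite (eq_bigr (fun T' => ip (B T') J J)); last by move=> T' _; rewrite l2norm_vec_sqr.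
  rewrite -ipN// -l2norm_vec_sqr lerXn2r ?nnegrE ?l2norm_vec_ge0//.
  exact: le_l2norm_vecS.
have [->|n0] := eqVneq (l2norm_vec Om J) 0.
  by rewrite !mulr_ge0 ?invr_ge0 ?(ltW hlambda).
have npos : 0 < l2norm_vec Om J by rewrite lt_def n0 l2norm_vec_ge0.
rewrite -mulrA ler_pdivlMl// -(ler_pM2r npos) -mulrA -expr2.
exact: key.
Qed.

Lemma semi1_corrector_diff T v : VH Om M v ->
  semi1 Om Om (Qxi T v \- Qpsi T v) = l2norm_vec Om (jump T v).
Proof.
move=> hv; rewrite /semi1 setIid.
have hx := corrector_H1 hQxi T hv; have hp := corrector_H1 hQpsi T hv.
have hw := is_wgradB oOm hx hp.
have hD := L2B mO hx.1 hp.1.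
apply: (eq_ae_l2norm_vec mO); [|exact: L2v_jump|exact: wgrad_ae].
by apply: L2v_wgrad; split => //; eexists; exact: hw.
Qed.

(** At almost every point of an element [T0] only the elements with [T0] in
    their patch contribute.  By symmetry these are the elements of the patch of
    [T0], at most [Col] many, and the square of their sum is at most [Col] times
    the sum of their squares. *)
Lemma global_jump_estimate (Col : R) v :
  (forall T, #|layers k T|%:R <= Col) -> VH Om M v ->
  l2norm_vec Om (fun x => \sum_T jump T v x) ^+ 2 <=
  Col * \sum_T l2norm_vec Om (jump T v) ^+ 2.
Proof.
move=> hCol hv.
have hJ T : L2v Om (jump T v) := L2v_jump T hv.
have hS : L2v Om (fun x => \sum_T jump T v x) by exact: L2v_sum.
pose f x := \sum_T dot (jump T v x) (jump T v x).
have intf : mu.-integrable Om (EFin \o f).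
  rewrite (_ : _ \o _ = fun x => (\sum_T (dot (jump T v x) (jump T v x))%:E)%E).
    by apply: integrable_sum => // T _; exact: dot_integrable.
  by apply/funext => x /=; rewrite sumEFin.
have -> : \sum_T l2norm_vec Om (jump T v) ^+ 2 = \int[mu]_(x in Om) f x.
  rewrite /f /Rintegral; under eq_integral => x _ do rewrite -sumEFin.
  rewrite integral_sum//; last by move=> T; exact: dot_integrable.
  under [in RHS]eq_bigr => T _ do
    rewrite -(fineK (integrable_fin_num mO (dot_integrable mO (hJ T) (hJ T)))).
  by rewrite sumEFin; apply: eq_bigr => T _; rewrite l2norm_vec_sqr.
rewrite l2norm_vec_sqr /ip -RintegralZl//.
apply: ae_le_Rintegral => //; first exact: dot_integrable.
  by have := integrableZl mO Col intf; congr (_.-integrable _ _).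
have out : \forall x \ae mu, forall T, (Om `\` N T) x -> jump T v x = 0.
  by apply: filter_forall => T; exact: jump_out.
have nov : \forall x \ae mu, ~ @overlaps _ _ M x.
  by apply: negligibleS (negligible_overlaps hM) => x /= /contrapT.
apply: filterS2 out nov => x out nov Ox.
have [T0 T0x] := bodies_cover hM Ox.
have zero T : T \notin layers k T0 -> jump T v x = 0.
  move=> hT; apply: out; split => // -[[T' /= T'T T'x] _].
  move/negP: hT; apply; apply: layers_sym; rewrite (_ : T0 = T')//.
  by apply/eqP/negPn/negP => TT'; apply: nov; exists T0, T'.
have E (V : nmodType) (g : elt M -> V) : (forall T, T \notin layers k T0 -> g T = 0) ->
    \sum_T g T = \sum_(T in layers k T0) g T.
  move=> g0; rewrite (bigID (mem (layers k T0)))/= [X in _ + X]big1 ?addr0//.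
rewrite /f !E //; last by move=> T hT; rewrite zero// dot0l.
apply: (@le_trans _ _ (#|layers k T0|%:R * \sum_(T in layers k T0) dot (jump T v x) (jump T v x))).
  rewrite /dot exchange_big /= mulr_sumr; apply: ler_sum => i _.
  rewrite summxE -expr2.
  have := sum_CS (index_enum (elt M)) (fun T => T \in layers k T0) (fun=> 1)
    (fun T => jump T v x ord0 i).
  have -> : \sum_(T in layers k T0) 1 * jump T v x ord0 i =
      \sum_(T in layers k T0) jump T v x ord0 i.
    by apply: eq_bigr => T _; rewrite mul1r.
  move=> /le_trans; apply; rewrite expr1n sumr_const.
  by rewrite ler_wpM2l//; apply: ler_sum => T _; rewrite expr2.
by rewrite ler_wpM2r// sumr_ge0// => T _; exact: dot_ge0.
Qed.

Lemma global_estimate (Col : R) v :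
  (forall T, #|layers k T|%:R <= Col) -> VH Om M v ->
  semi1 Om Om (global_corrector Qxi v \- global_corrector Qpsi v)
  <= lambda^-1 * Num.sqrt Col * (\big[Num.max/0]_T e_ T) * semi1 Om Om v.
Proof.
move=> hCol hv; set em := \big[Num.max/0]_T e_ T.
have em0 : 0 <= em by exact: bigmax_ge_id.
have L2diff T : L2 Om (Qxi T v \- Qpsi T v).
  exact: L2B mO (corrector_H1 hQxi T hv).1 (corrector_H1 hQpsi T hv).1.
have wJ T : is_wgrad Om (Qxi T v \- Qpsi T v) (jump T v).
  exact: is_wgradB (corrector_H1 hQxi T hv) (corrector_H1 hQpsi T hv).
have -> : global_corrector Qxi v \- global_corrector Qpsi v =
    (fun x => \sum_T (Qxi T v \- Qpsi T v) x).
  by apply/funext => x; rewrite /global_corrector /= -sumrB.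
have wS := is_wgrad_sum (index_enum (elt M)) oOm L2diff wJ.
have hS : L2v Om (fun x => \sum_T jump T v x) by apply: L2v_sum => // T; exact: L2v_jump.
rewrite {1}/semi1 setIid (@eq_ae_l2norm_vec _ _ Om _ (fun x => \sum_T jump T v x))//; last 2 first.
- by apply: L2v_wgrad; split; [exact: L2_sum|eexists; exact: wS].
- by apply: wgrad_ae => //; exact: L2_sum.
(* Without elements nothing says that [Col] is nonnegative. *)
have Col0 : (\sum_T l2norm_vec Om (jump T v) ^+ 2 = 0) \/ 0 <= Col.
  have [T|noT] := pickP (fun _ : elt M => true).
    by right; apply: le_trans (hCol T).
  by left; rewrite big1// => T _; have := noT T.
have gj := global_jump_estimate hCol hv.
have r0 : 0 <= lambda^-1 by rewrite invr_ge0 ltW.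
have rhs0 : 0 <= lambda^-1 * Num.sqrt Col * em * semi1 Om Om v by rewrite !mulr_ge0 ?sqrtr_ge0.
rewrite -(@ler_pXn2r _ 2)// ?nnegrE ?l2norm_vec_ge0//.
apply: (le_trans gj); have [->|{}Col0] := Col0; first by rewrite mulr0 sqr_ge0.
rewrite !exprMn sqr_sqrtr// [_ * Col]mulrC -!mulrA ler_wpM2l//.
have -> : semi1 Om Om v ^+ 2 = \sum_(T : elt M) semi1 Om (body T) v ^+ 2.
  have hgv : L2v Om (wgrad Om v) := L2v_wgrad (VH_H1 hv).
  rewrite /semi1 setIid l2norm_vec_sqr /ip.
  have OmE : region [set: elt M] `&` Om = Om.
    apply/setIidr => x Ox.
    by have [T Tx] := bodies_cover hM Ox; exists T => //=; rewrite inE.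
  rewrite -{1}OmE.
  rewrite (Rintegral_region oOm hM); last exact: dot_integrable.
  by apply: eq_big => [T|T _]; rewrite ?inE// l2norm_vec_sqr.
rewrite !mulr_sumr; apply: ler_sum => T _.
set s := semi1 Om (body T) v; have s0 : 0 <= s := sqrtr_ge0 _.
have -> : lambda^-1 * (lambda^-1 * (em * (em * s ^+ 2))) = (lambda^-1 * em * s) ^+ 2 by ring.
rewrite lerXn2r ?nnegrE ?l2norm_vec_ge0 ?(mulr_ge0 (mulr_ge0 r0 em0) s0)//.
apply: (le_trans (jump_estimate T hv)).
by rewrite ler_wpM2r// ler_wpM2l// le_bigmax.
Qed.

End corrector_stability.

Theorem lemma8 (R : realType) (d : nat) (hd : (1 <= d <= 3)%N)
  (Om : set 'rV[R]_d) (hOm : lipschitz_domain Om)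
  (alpha : 'rV[R]_d -> R -> R) (Lc lambda Lambda : R)
  (hLc : 0 < Lc) (hlambda : 0 < lambda) (hLambda : 0 < Lambda)
  (halpha : coefficient Om alpha Lc lambda Lambda)
  (M : cells R d) (hM : is_mesh Om M)
  (sigma tau : R) (hsigma : shape_regular M sigma) (htau : quasi_uniform M tau)
  (I : ('rV[R]_d -> R) -> 'rV[R]_d -> R) (Cproj : R)
  (hI : is_interpolation Om M Cproj I)
  (k : nat) (hk : (1 <= k)%N)
  (Col : R) (hCol : forall T : elt M, #|layers k T|%:R <= Col)
  (psi xi : 'rV[R]_d -> R) (hpsi : H10 Om psi) (hxi : H10 Om xi)
  (Qpsi Qxi : elt M -> ('rV[R]_d -> R) -> 'rV[R]_d -> R)
  (hQpsi : is_corrector Om alpha I k psi Qpsi)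
  (hQxi : is_corrector Om alpha I k xi Qxi) :
  (forall (v : 'rV[R]_d -> R) (T : elt M), VH Om M v ->
     semi1 Om Om (Qxi T v \- Qpsi T v)
     <= lambda^-1 * eT Om alpha k Qpsi xi psi T * semi1 Om (body T) v) /\
  (forall v : 'rV[R]_d -> R, VH Om M v ->
     semi1 Om Om (global_corrector Qxi v \- global_corrector Qpsi v)
     <= lambda^-1 * Num.sqrt Col
        * (\big[Num.max/0]_(T : elt M) eT Om alpha k Qpsi xi psi T)
        * semi1 Om Om v).
Proof.
have [oOm _ _ _ _] := hOm.
case: d => [|d] in hd Om hOm alpha halpha M hM hsigma htau I hI hCol psi xi hpsi hxi
  Qpsi Qxi hQpsi hQxi oOm *; first by [].
split => [v T|v] hv.
  rewrite (semi1_corrector_diff oOm hQpsi hQxi T hv).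
  exact: (jump_estimate oOm hLc hlambda hLambda halpha hM hpsi hxi hQpsi hQxi T hv).
exact: (global_estimate oOm hLc hlambda hLambda halpha hM hpsi hxi hQpsi hQxi hCol hv).
Qed.
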